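(* Consider a four-dimensional CFT dual to quadratic curvature gravity with couplings $\alpha_1,\alpha_2,\alpha_3$ and AdS$_5$ vacuum of effective radius $L_\star$. For a cylindrical entangling region of radius $l$ and length $H$ in the vacuum state, the universal (logarithmic) part of the holographic entanglement entropy is $$-\tilde a_4\,\frac{\pi HL_\star^3}{16\,l\,G_N}\log\frac l\delta,\qquad \tilde a_4=1-\frac{4}{L_\star^2}(10\alpha_1+2\alpha_2+\alpha_3).$$ Comparing with the general CFT result $-\frac{cH}{2l}\log\frac l\delta$, the type-B anomaly coefficient is $$c=\tilde a_4\,\frac{\pi L_\star^3}{8G_N}.$$
   Context: Gravity Lagrangian: $\frac{1}{16\pi G_N}[R-2\Lambda+\alpha_1R^2+\alpha_2R_{ab}R^{ab}+\alpha_3\mathcal{X}_4]$, $\mathcal{X}_4=R^2-4R_{ab}R^{ab}+R_{abcd}R^{abcd}$. Vacuum: Euclidean AdS$_5$, $ds^2=\frac{L_\star^2}{z^2}(dt^2+dz^2+dx_3^2+dr^2+r^2d\theta^2)$, with $R_{ab}{}^{cd}=-\frac{1}{L_\star^2}(\delta^c_a\delta^d_b-\delta^d_a\delta^c_b)$. Entropy functional for a codimension-two surface $\Gamma$: $$S_{\rm EE}=\frac{1}{4G_N}\int_\Gamma d^3x\sqrt{{}_\Gamma g}\Big[1+2\alpha_1R+\alpha_2\big(R^{(m)(m)}-\tfrac12\mathcal{K}^{(m)}\mathcal{K}^{(m)}\big)+2\alpha_3\tilde R\Big],$$ where $R$ is the ambient Ricci scalar, $R^{(m)(m)}$ the sum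 over the two unit normals of the Ricci tensor contracted twice with the normal, $\mathcal{K}^{(m)}$ the traces of the extrinsic curvatures and $\tilde R$ the intrinsic Ricci scalar of $\Gamma$. For the cylinder of radius $l$ extended along $x_3$ ($0\le x_3\le H$), the extremal surface near the boundary is $\Gamma=\{t=\mathrm{const},\ r=l[1-\frac{z^2}{4l^2}+O(z^4)]\}$, regulated by $z\ge\delta$. The universal part is the $\log(l/\delta)$ term in the expansion of $S_{\rm EE}$ as $\delta\to0$. *)

(* Defs.v *)
From HB Require Import structures.
From mathcomp Require Import all_boot all_order all_algebra.
From mathcomp Require Import Rstruct.
From Stdlib Require Import Reals Lra.
From Coquelicot Require Import Coquelicot.

Set Implicit Arguments.
Unset Strict Implicit.
Unset Printing Implicit Defensive.

(* Stdlib's R with Coquelicot's derivatives, integrals and limits;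
   determinants, inverse matrices and finite index types are MathComp's, over
   the field structure that Rstruct puts on R. *)

Open Scope ring_scope.
Open Scope R_scope.

(* MathComp's \sum, restated with Rplus in R_scope *)
Notation "\sum_ ( i < n ) F" := (\big[Rplus/0%R]_(i < n) F%R) : R_scope.
Notation "\sum_ ( m <= i < n ) F" := (\big[Rplus/0%R]_(m <= i < n) F%R) : R_scope.

(** * Coordinate tensor calculus *)

Definition point (n : nat) := 'I_n -> R.

Definition vec (n : nat) (s : seq R) : point n := fun i => nth 0 s i.
Arguments vec : clear implicits.

Definition upd n (p : point n) (i : 'I_n) (x : R) : point n :=
  fun j => if j == i then x else p j.

Definition partial n (i : 'I_n) (f : point n -> R) : point n -> R :=
  fun p => Derive (fun x => f (upd p i x)) (p i).

Definition smooth n (f : point n -> R) : Prop :=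
  forall (s : seq 'I_n) (i : 'I_n) (p : point n),
    let h := foldr (@partial n) f s in
    ex_derive (fun x => h (upd p i x)) (p i)
    /\ @continuous (fct_UniformSpace 'I_n R_UniformSpace) R_UniformSpace h p.

Definition smooth1 (f : R -> R) : Prop := forall k x, ex_derive_n f k x.

Definition metric n := point n -> 'M[R]_n.

Section Curvature.
Variables (n : nat) (g : metric n).

Definition ginv (a b : 'I_n) (p : point n) : R := invmx (g p) a b.

(* Gamma^a_{bc} *)
Definition christoffel (a b c : 'I_n) (p : point n) : R :=
  / 2 * \sum_(d < n) (ginv a d p *
    (partial b (fun q => g q d c) p + partial c (fun q => g q d b) p
     - partial d (fun q => g q b c) p)).

(* R^a_{bcd}, with the sign for which round spheres have R > 0 *)
Definition riemann (a b c d : 'I_n) (p : point n) : R :=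
  partial c (christoffel a d b) p - partial d (christoffel a c b) p
  + \sum_(e < n) (christoffel a c e p * christoffel e d b p
                  - christoffel a d e p * christoffel e c b p).

Definition ricci (b d : 'I_n) (p : point n) : R :=
  \sum_(a < n) riemann a b a d p.

Definition scalar_curvature (p : point n) : R :=
  \sum_(a < n) \sum_(b < n) (ginv a b p * ricci a b p).

(* R_{ab} R^{ab} *)
Definition ricci_sq (p : point n) : R :=
  \sum_(a < n) \sum_(b < n) \sum_(c < n) \sum_(d < n)
    (ginv a c p * ginv b d p * ricci a b p * ricci c d p).

(* R_{abcd} R^{abcd} = g_{ae} g^{bf} g^{ch} g^{dk} R^a_{bcd} R^e_{fhk} *)
Definition riemann_sq (p : point n) : R :=
  \sum_(a < n) \sum_(b < n) \sum_(c < n) \sum_(d < n)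
  \sum_(e < n) \sum_(f < n) \sum_(h < n) \sum_(k < n)
    (g p a e * ginv b f p * ginv c h p * ginv d k p
     * riemann a b c d p * riemann e f h k p).

Definition euler4 (p : point n) : R :=
  (scalar_curvature p) ^ 2 - 4 * ricci_sq p + riemann_sq p.

Definition inner (p v w : point n) : R :=
  \sum_(a < n) \sum_(b < n) (g p a b * v a * w b).

End Curvature.

(** * Submanifolds [X] of R^n with normal fields [N], parametrised by R^k *)

Section Embedding.
Variables (n k : nat) (g : metric n) (X : point k -> point n).

Definition tangent (i : 'I_k) (u : point k) : point n :=
  fun a => partial i (fun w => X w a) u.

Definition induced : metric k := fun u =>
  \matrix_(i, j) inner g (X u) (tangent i u) (tangent j u).

(* Derivative along the i-th tangent vector of a vector field N on the
   submanifold, for the Levi-Civita connection of g. *)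
Definition covariant (i : 'I_k) (N : point k -> point n) (u : point k) : point n :=
  fun a => partial i (fun w => N w a) u
    + \sum_(b < n) \sum_(c < n)
        (christoffel g a b c (X u) * tangent i u b * N u c).

(* K_{ij} = e_i^a e_j^b \nabla_a N_b *)
Definition extrinsic (N : point k -> point n) (i j : 'I_k) (u : point k) : R :=
  inner g (X u) (tangent j u) (covariant i N u).

Definition extrinsic_trace (N : point k -> point n) (u : point k) : R :=
  \sum_(i < k) \sum_(j < k) (ginv induced i j u * extrinsic N i j u).

Definition unit_normal_frame m (N : 'I_m -> point k -> point n) (u : point k) :=
  (forall a b, inner g (X u) (N a u) (N b u) = if a == b then 1 else 0)
  /\ (forall a i, inner g (X u) (N a u) (tangent i u) = 0).

End Embedding.

(** * Quadratic curvature gravity in five dimensions *)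

Record quadratic_gravity := QuadraticGravity {
  newton : R;   (* G_N *)
  cosmo : R;    (* Lambda *)
  alpha1 : R;
  alpha2 : R;
  alpha3 : R
}.

Definition lagrangian (th : quadratic_gravity) (g : metric 5) (p : point 5) : R :=
  / (16 * PI * newton th) *
  (scalar_curvature g p - 2 * cosmo th
   + alpha1 th * (scalar_curvature g p) ^ 2
   + alpha2 th * ricci_sq g p
   + alpha3 th * euler4 g p).

(* The action on the coordinate box prod_i [a i, b i] *)
Definition action (th : quadratic_gravity) (g : metric 5) (a b : point 5) : R :=
  let lo i := a (inord i) in
  let hi i := b (inord i) in
  RInt (fun x0 => RInt (fun x1 => RInt (fun x2 => RInt (fun x3 => RInt (fun x4 =>
    let p := vec 5 [:: x0; x1; x2; x3; x4] in
    sqrt (\det (g p)) * lagrangian th g p)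
  (lo 4%nat) (hi 4%nat)) (lo 3%nat) (hi 3%nat)) (lo 2%nat) (hi 2%nat))
  (lo 1%nat) (hi 1%nat)) (lo 0%nat) (hi 0%nat).

(* g is a vacuum on the open coordinate domain U: the action is stationary
   under every smooth variation of the metric supported in a box inside U. *)
Definition is_vacuum (th : quadratic_gravity) (U : point 5 -> Prop) (g : metric 5) :=
  forall (a b : point 5) (k : metric 5),
    (forall i, a i < b i) ->
    (forall p, (forall i, a i <= p i <= b i) -> U p) ->
    (forall i j, smooth (fun p => k p i j)) ->
    (forall p i j, k p i j = k p j i) ->
    (forall p, ~ (forall i, a i < p i < b i) -> forall i j, k p i j = 0) ->
    is_derive
      (fun s : R => action th (fun p => \matrix_(i, j) (g p i j + s * k p i j)) a b)
      0 0.

(* Coordinates of the ambient space, in this order: t, z, x3, r, theta *)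
Definition z_ : 'I_5 := inord 1.
Definition r_ : 'I_5 := inord 3.

Definition poincare_domain (p : point 5) : Prop := 0 < p z_ /\ 0 < p r_.

(* (L^2 / z^2) (dt^2 + dz^2 + dx3^2 + dr^2 + r^2 dtheta^2) *)
Definition ads5 (L : R) : metric 5 := fun p =>
  \matrix_(i, j)
    (if i == j then L ^ 2 / (p z_) ^ 2 * vec 5 [:: 1; 1; 1; 1; (p r_) ^ 2] i
     else 0).

(** * The entropy functional *)

Section Entropy.
Variables (th : quadratic_gravity) (g : metric 5).
Variables (X : point 3 -> point 5) (N : 'I_2 -> point 3 -> point 5).

(* R^{(m)(m)} *)
Definition ricci_normal (u : point 3) : R :=
  \sum_(m < 2) \sum_(a < 5) \sum_(b < 5) (ricci g a b (X u) * N m u a * N m u b).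

(* K^{(m)} K^{(m)} *)
Definition extrinsic_trace_sq (u : point 3) : R :=
  \sum_(m < 2) (extrinsic_trace g X (N m) u) ^ 2.

Definition entropy_density (u : point 3) : R :=
  sqrt (\det (induced g X u)) *
  (1 + 2 * alpha1 th * scalar_curvature g (X u)
   + alpha2 th * (ricci_normal u - / 2 * extrinsic_trace_sq u)
   + 2 * alpha3 th * scalar_curvature (induced g X) u).

End Entropy.

(** * The cylinder *)

(* Surface t = t0, r = rho z, parametrised by u = (z, theta, x3) *)
Definition cylinder (t0 : R) (rho : R -> R) : point 3 -> point 5 := fun u =>
  let z := u (inord 0) in let theta := u (inord 1) in let x3 := u (inord 2) in
  vec 5 [:: t0; z; x3; rho z; theta].

(* Its unit normals for [ads5 L]: (z/L) d_t and
   (z/L) (d_r - rho' d_z) / sqrt (1 + rho'^2) *)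
Definition cylinder_normals (L : R) (rho : R -> R) : 'I_2 -> point 3 -> point 5 :=
  fun m u =>
  let z := u (inord 0) in
  let d := Derive rho z in
  if m == ord0 then vec 5 [:: z / L; 0; 0; 0; 0]
  else vec 5 [:: 0; - (z / L * d / sqrt (1 + d ^ 2)); 0;
                 z / L / sqrt (1 + d ^ 2); 0].

Lemma inner_ads5 (L : R) (p v w : point 5) :
  inner (ads5 L) p v w = L ^ 2 / (p z_) ^ 2 *
    \sum_(i < 5) (vec 5 [:: 1; 1; 1; 1; (p r_) ^ 2] i * v i * w i).
Proof.
rewrite /inner /ads5 !big_ord_recl !big_ord0 !mxE /=.
by rewrite /vec /=; ring.
Qed.

Lemma cylinder_unit_normals (L t0 : R) (rho : R -> R) (u : point 3) :
  0 < L -> 0 < u (inord 0) -> ex_derive rho (u (inord 0)) ->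
  unit_normal_frame (ads5 L) (cylinder t0 rho) (cylinder_normals L rho) u.
Proof.
move=> HL Hz Hrho.
set z := u (inord 0) in Hz Hrho *; set d := Derive rho z.
have Hw : 0 < 1 + d ^ 2 by have := pow2_ge_0 d; lra.
have Hs := sqrt_lt_R0 _ Hw.
have Hs2 : sqrt (1 + d ^ 2) * sqrt (1 + d ^ 2) = 1 + d ^ 2 by apply: sqrt_sqrt; lra.
have Ez : cylinder t0 rho u z_ = z by rewrite /cylinder /vec /z_ inordK.
split.
- move=> a b; rewrite inner_ads5 Ez !big_ord_recl big_ord0 /cylinder_normals -/z -/d.
  case: (unliftP ord0 a) => [a' ->|->]; case: (unliftP ord0 b) => [b' ->|->];
    rewrite ?(ord1 a') ?(ord1 b') /vec /=; move: (Hs) => /= Hs'; try by field; lra.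
  have -> : L ^ 2 / z ^ 2 * (1 * 0 * 0 + (1 * - (z / L * d / sqrt (1 + d * (d * 1))) * - (z / L * d / sqrt (1 + d * (d * 1))) + (1 * 0 * 0 + (1 * (z / L / sqrt (1 + d * (d * 1))) * (z / L / sqrt (1 + d * (d * 1))) + (cylinder t0 rho u r_ * (cylinder t0 rho u r_ * 1) * 0 * 0 + 0))))) = (1 + d ^ 2) / (sqrt (1 + d ^ 2) * sqrt (1 + d ^ 2)).
    by rewrite /=; field; lra.
  by rewrite Hs2; field; lra.
- move=> a i; rewrite inner_ads5 Ez.
  have Et : tangent (cylinder t0 rho) i u =1
     (if i == inord 0 then vec 5 [:: 0; 1; 0; d; 0]
      else if i == inord 1 then vec 5 [:: 0; 0; 0; 0; 1]
      else vec 5 [:: 0; 0; 1; 0; 0]).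
    rewrite /tangent /partial => c; rewrite /cylinder /upd /vec /=.
    case: i => -[|[|[|//]]] Hi; case: c => -[|[|[|[|[|//]]]]] Hc;
      rewrite /= -?(inj_eq val_inj) /= ?inordK //= -?(inj_eq val_inj) /= ?inordK //=;
      try exact: Derive_const; try exact: Derive_id.
    by rewrite /d /z; congr (Derive _ (u _)); apply: val_inj; rewrite /= inordK.
  rewrite !big_ord_recl big_ord0 !Et /cylinder_normals -/z -/d.
  case: (unliftP ord0 a) => [a' ->|->]; rewrite ?(ord1 a') /=;
  by case: ifP => _; [|case: ifP => _]; rewrite /vec /=; move: (Hs) => /= Hs'; (ring || (field; lra)).
Qed.

(* S_EE of the part za <= z <= zb of the surface, 0 <= theta <= 2 pi,
   0 <= x3 <= H *)
Definition cylinder_entropy (th : quadratic_gravity) (L H t0 : R) (rho : R -> R)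
    (za zb : R) : R :=
  / (4 * newton th) *
  RInt (fun z => RInt (fun theta => RInt (fun x3 =>
    entropy_density th (ads5 L) (cylinder t0 rho) (cylinder_normals L rho)
      (vec 3 [:: z; theta; x3])) 0 H) 0 (2 * PI)) za zb.

(* Stationarity of S_EE on 0 < z < zmax under compactly supported variations
   of the profile.  Variations that break the symmetry of the cylinder add
   nothing to this condition (symmetric criticality). *)
Definition is_extremal (th : quadratic_gravity) (L H t0 zmax : R) (rho : R -> R) :=
  forall (za zb : R) (eta : R -> R),
    0 < za -> za < zb -> zb < zmax ->
    smooth1 eta ->
    (forall z, ~ (za < z < zb) -> eta z = 0) ->
    is_derive
      (fun s : R => cylinder_entropy th L H t0 (fun z => rho z + s * eta z) za zb)
      0 0.

(* rho z = l (1 - z^2 / (4 l^2) + O(z^4)) as z -> 0+, as an expansion that may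
   be differentiated termwise twice.  The factor 1 + |ln z| makes room for the
   z^4 log z term that the Fefferman-Graham type expansion of an extremal
   surface of this dimension has; a remainder that is O(z^4) without logarithms
   satisfies the condition a fortiori. *)
Definition near_boundary_expansion (l : R) (rho : R -> R) : Prop :=
  exists C eps : R, 0 < eps /\
    forall (k : nat) (z : R), (k <= 2)%nat -> 0 < z < eps ->
      Rabs (Derive_n (fun y => rho y - l * (1 - y ^ 2 / (4 * l ^ 2))) k z)
      <= C * z ^ (4 - k)%nat * (1 + Rabs (ln z)).

(* B * log (l / delta) is the logarithmic term of S delta as delta -> 0+:
   S delta = sum_(1 <= k <= K) a_k / delta^k + B log (l / delta) + C + o(1) *)
Definition has_log_term (S : R -> R) (l B : R) : Prop :=
  exists (K : nat) (a : nat -> R) (C : R),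
    filterlim
      (fun delta => S delta - \sum_(1 <= k < K.+1) (a k / delta ^ k)
                    - B * ln (l / delta))
      (at_right 0) (locally C).

Definition a4_tilde (th : quadratic_gravity) (L : R) : R :=
  1 - 4 / L ^ 2 * (10 * alpha1 th + 2 * alpha2 th + alpha3 th).

(* Coefficient of log (l / delta) in the entanglement entropy of a cylinder of
   radius l and length H, in a four-dimensional CFT of type-B anomaly c *)
Definition cft_cylinder_coefficient (c l H : R) : R := - (c * H / (2 * l)).

(* Main.v *)
(** In Poincare coordinates AdS5 is Einstein with R_ab = -(4/L^2) g_ab, so on the
    surface r = rho(z) only the mean curvature K of the normal in the (z, r)-plane
    and the intrinsic curvature of the induced diagonal metric vary.  Put
    W = 1 + rho'^2, q = rho'/z and s = rho''; these are regular at z = 0, and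
      K  = z / (L sqrt W) * (1/rho + 3 q - s/W),
      R~ = - 2 / (L^2 W) * (3 + z^2 (s/(rho W) - 2 q/rho + 2 q s/W)).
    The prescribed expansion of rho gives q, s = -1/(2l) + O(z).  The bracket in K
    is then O(z), so the K^2 term does not contribute, and the entropy density is
    L^3 (a/z^3 + b/z) + O(1) with b = - a4_tilde / (8 l); integration produces the
    logarithm with coefficient L^3 b.

    The coefficient of a logarithm is unique: comparing an expansion at delta and
    at delta/2 turns the difference of two candidates into the constant term of a
    polynomial in 1/delta that tends to 0, hence vanishes. *)

Require Import Defs.
From mathcomp Require Import all_boot all_order all_algebra.
From mathcomp Require Import Rstruct.
From Stdlib Require Import Reals Lra.
From Coquelicot Require Import Coquelicot.
Open Scope ring_scope.
Open Scope R_scope.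
Delimit Scope ring_scope with ring.

(** * Diagonal metrics *)

(** Both the AdS metric and the induced metric of the cylinder have this shape, so every curvature
    below is computed through it. *)
Definition diagonal_metric n (h : 'I_n -> point n -> R) : metric n :=
  fun p => \matrix_(i, j) (if i == j then h i p else 0).

Lemma diagonal_metric_diag_mx n (h : 'I_n -> point n -> R) (p : point n) :
  diagonal_metric n h p = diag_mx (\row_i h i p)%R.
Proof.
by apply/matrixP => i j; rewrite !mxE; case: eqP => [->|_]; rewrite ?GRing.mulr1n ?GRing.mulr0n.
Qed.

(** The diagonal matrix of reciprocals is a right inverse, and for square matrices this already
    determines [invmx]. *)
Lemma diagonal_metric_ginv n (h : 'I_n -> point n -> R) (p : point n) :
  (forall i, h i p <> 0) ->
  forall a b, ginv (diagonal_metric n h) a b p = if a == b then / h a p else 0.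
Proof.
move=> hN0 a b.
pose B := (diag_mx (\row_i (/ h i p)))%R : 'M[R]_n.
have Hm : (diagonal_metric n h p *m B = 1%:M)%R.
  rewrite diagonal_metric_diag_mx mulmx_diag; apply/matrixP => i j.
  by rewrite !mxE; case: eqP => [->|_] //; congr (_ *+ _)%R; exact: Rinv_r (hN0 _).
have [uG _] := mulmx1_unit Hm.
have -> : ginv (diagonal_metric n h) a b p = B a b.
  by rewrite /ginv -[invmx _](mulmx1) -Hm mulmxA (mulVmx uG) mul1mx.
by rewrite !mxE; case: eqP => [->|_]; rewrite ?GRing.mulr1n ?GRing.mulr0n.
Qed.

Lemma big_Rplus_only1 n (i : 'I_n) (F : 'I_n -> R) :
  (forall j, j != i -> F j = 0) -> \sum_(j < n) F j = F i.
Proof. by move=> H; rewrite (bigD1 i) //= big1 => [|j /H //]; rewrite Rplus_0_r. Qed.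

Lemma partial_diagonal_metric n (h : 'I_n -> point n -> R) (p : point n) (i a b : 'I_n) :
  partial i (fun q => diagonal_metric n h q a b) p = if a == b then partial i (h a) p else 0.
Proof.
rewrite /partial; case: eqP => [->|H].
  by apply: Derive_ext => x; rewrite mxE eqxx.
rewrite -[RHS](Derive_const 0 (p i)); apply: Derive_ext => x; rewrite mxE.
by case: eqP.
Qed.

Lemma diagonal_metric_christoffel n (h : 'I_n -> point n -> R) (p : point n) :
  (forall i, h i p <> 0) ->
  forall a b c, christoffel (diagonal_metric n h) a b c p =
    / (2 * h a p) * ((if a == c then partial b (h a) p else 0)
                   + (if a == b then partial c (h a) p else 0)
                   - (if b == c then partial a (h b) p else 0)).
Proof.
move=> hN0 a b c; rewrite /christoffel (big_Rplus_only1 _ a); last first.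
  by move=> d Hd; rewrite diagonal_metric_ginv // eq_sym (negbTE Hd) Rmult_0_l.
rewrite !partial_diagonal_metric diagonal_metric_ginv // eqxx Rinv_mult; ring.
Qed.

Lemma diagonal_metric_scalar_curvature n (h : 'I_n -> point n -> R) (p : point n) :
  (forall i, h i p <> 0) ->
  scalar_curvature (diagonal_metric n h) p =
  \sum_(a < n) (/ h a p * ricci (diagonal_metric n h) a a p).
Proof.
move=> hN0; apply: eq_bigr => a _; rewrite (big_Rplus_only1 _ a) ?diagonal_metric_ginv ?eqxx //.
by move=> b Hb; rewrite diagonal_metric_ginv // eq_sym (negbTE Hb) Rmult_0_l.
Qed.

Lemma diagonal_metric_det n (h : 'I_n -> point n -> R) (p : point n) :
  \det (diagonal_metric n h p) = \big[Rmult/1]_(i < n) h i p.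
Proof.
by rewrite diagonal_metric_diag_mx det_diag; apply: eq_bigr => i _; rewrite mxE.
Qed.

(** Curvature differentiates the metric, so an identity between metrics has to be rewritten as an
    equality of fields and not at one point only. *)
Lemma metric_ext n (g1 g2 : metric n) : (forall p, g1 p = g2 p) -> g1 = g2.
Proof. exact: FunctionalExtensionality.functional_extensionality. Qed.

(** * Anti-de Sitter space *)

(** Taken on natural numbers, so that it computes once an ordinal index has been destructed. *)
Definition kron (i j : nat) : R := if i == j then 1 else 0.

Definition ads5_factor (L : R) (i : 'I_5) (p : point 5) : R :=
  L ^ 2 / (p z_) ^ 2 * vec 5 [:: 1; 1; 1; 1; (p r_) ^ 2] i.

Lemma ads5_diagonal (L : R) : ads5 L = diagonal_metric 5 (ads5_factor L).
Proof. by []. Qed.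

Lemma ads5_factor_neq0 (L : R) (p : point 5) (i : 'I_5) :
  0 < L -> 0 < p z_ -> 0 < p r_ -> ads5_factor L i p <> 0.
Proof.
move=> HL Hz Hr; apply: Rgt_not_eq; apply: Rmult_lt_0_compat.
  by apply: Rdiv_lt_0_compat; apply: pow_lt.
by case: i => -[|[|[|[|[|//]]]]] Hi; rewrite /vec /=; try exact: Rlt_0_1; apply: (pow_lt _ 2).
Qed.

Lemma upd_eq n (p : point n) (i j : 'I_n) (x : R) : upd p i x j = if j == i then x else p j.
Proof. by []. Qed.

(** The factor [1 + kron i 4 * (r ^ 2 - 1)] is [r ^ 2] in the theta direction and 1 in the others;
    it keeps all components in a single formula. *)
Lemma partial_ads5_factor (L : R) (p : point 5) (i j : 'I_5) :
  0 < p z_ ->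
  partial j (ads5_factor L i) p =
    kron j 1 * (- 2 * L ^ 2 / (p z_) ^ 3 * (1 + kron i 4 * (p r_ ^ 2 - 1)))
    + kron j 3 * kron i 4 * (2 * L ^ 2 / (p z_) ^ 2 * p r_).
Proof.
move=> Hz; rewrite /partial /ads5_factor.
apply: is_derive_unique.
have Ez : (z_ == j) = (nat_of_ord j == 1%nat) by rewrite -(inj_eq val_inj) /= inordK // eq_sym.
have Er : (r_ == j) = (nat_of_ord j == 3%nat) by rewrite -(inj_eq val_inj) /= inordK // eq_sym.
rewrite /kron -Ez -Er.
(* The list lookup gives way to an expression in [kron i 4] that [auto_derive] can handle. *)
apply: (is_derive_ext (fun x => L ^ 2 / (if z_ == j then x else p z_) ^ 2 *
   (1 + kron i 4 * ((if r_ == j then x else p r_) ^ 2 - 1)))) => [x|].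
  rewrite !upd_eq /kron; move: (if r_ == j then _ else _) (if z_ == j then _ else _) => y w.
  by case: i => -[|[|[|[|[|//]]]]] Hi; rewrite /vec /=; ring.
have [E|_] := eqVneq z_ j; have [E'|_] := eqVneq r_ j.
(* The index cannot be z and r at once: that would make it both 1 and 3. *)
- by move: Ez Er; rewrite E E' eqxx => /esym/eqP ->.
- by rewrite -E /kron; auto_derive; [apply: Rgt_not_eq; apply: Rmult_lt_0_compat; lra|
   case: (nat_of_ord i == 4%nat); field; lra].
- by rewrite -E' /kron; auto_derive; [|
   case: (nat_of_ord i == 4%nat); field; lra].
- by rewrite /kron; auto_derive; [|ring].
Qed.

(** The term over [z] is the change of the Levi-Civita connection under the conformal factor
    [1 / z ^ 2]; the other two are the symbols of flat space in polar coordinates. The scale [L]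
    cancels. *)
Definition ads5_christoffel (a b c : nat) (z r : R) : R :=
  - (kron a b * kron c 1 + kron a c * kron b 1
     - kron a 1 * kron b c * (1 + kron b 4 * (r ^ 2 - 1))) / z
  - kron a 3 * kron b 4 * kron c 4 * r
  + kron a 4 * (kron b 3 * kron c 4 + kron b 4 * kron c 3) / r.

Lemma ads5_christoffelE (L : R) (p : point 5) (a b c : 'I_5) :
  0 < L -> 0 < p z_ -> 0 < p r_ ->
  christoffel (ads5 L) a b c p = ads5_christoffel a b c (p z_) (p r_).
Proof.
move=> HL Hz Hr; rewrite ads5_diagonal diagonal_metric_christoffel; last first.
  by move=> i; exact: ads5_factor_neq0.
rewrite !partial_ads5_factor // /ads5_factor /ads5_christoffel.
move: (p z_) (p r_) Hz Hr => z r Hz Hr.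
rewrite -!(inj_eq val_inj) /kron /vec.
case: a => -[|[|[|[|[|//]]]]] Ha; case: b => -[|[|[|[|[|//]]]]] Hb;
case: c => -[|[|[|[|[|//]]]]] Hc; rewrite /=; field; repeat split; lra.
Qed.

(** The closed form of the Christoffel symbols is available only where z and r are positive. This
    set is open and derivatives are local, so the closed form may be differentiated there. *)
Lemma partial_ads5_domain (f1 f2 : point 5 -> R) (p : point 5) (i : 'I_5) :
  0 < p z_ -> 0 < p r_ ->
  (forall q : point 5, 0 < q z_ -> 0 < q r_ -> f1 q = f2 q) ->
  partial i f1 p = partial i f2 p.
Proof.
move=> Hz Hr H; apply: Derive_ext_loc.
have Hpos (k : 'I_5) : 0 < p k -> locally (p i) (fun x => 0 < upd p i x k).
  move=> Hk; rewrite /upd; case: eqP => [E|_]; last exact: filter_forall.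
  by rewrite -E; apply: open_gt.
by apply: filter_imp (filter_and _ _ (Hpos _ Hz) (Hpos _ Hr)) => x [? ?]; apply: H.
Qed.

Lemma partial_ads5_christoffel (L : R) (p : point 5) (i a b c : 'I_5) :
  0 < L -> 0 < p z_ -> 0 < p r_ ->
  partial i (christoffel (ads5 L) a b c) p =
    kron i 1 * ((kron a b * kron c 1 + kron a c * kron b 1
     - kron a 1 * kron b c * (1 + kron b 4 * (p r_ ^ 2 - 1))) / p z_ ^ 2)
    + kron i 3 * (kron a 1 * kron b c * kron b 4 * (2 * p r_) / p z_
      - kron a 3 * kron b 4 * kron c 4
      - kron a 4 * (kron b 3 * kron c 4 + kron b 4 * kron c 3) / p r_ ^ 2).
Proof.
move=> HL Hz Hr.
rewrite (partial_ads5_domain _ (fun q => ads5_christoffel a b c (q z_) (q r_))) //; last first.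
  by move=> q; exact: ads5_christoffelE.
rewrite /partial /upd; apply: is_derive_unique.
have Ez : (z_ == i) = (nat_of_ord i == 1%nat) by rewrite -(inj_eq val_inj) /= inordK // eq_sym.
have Er : (r_ == i) = (nat_of_ord i == 3%nat) by rewrite -(inj_eq val_inj) /= inordK // eq_sym.
have -> : kron i 1 = if z_ == i then 1 else 0 by rewrite Ez.
have -> : kron i 3 = if r_ == i then 1 else 0 by rewrite Er.
rewrite /ads5_christoffel.
have [E|_] := eqVneq z_ i; have [E'|_] := eqVneq r_ i.
- by move: Ez Er; rewrite E E' eqxx => /esym/eqP ->.
- by rewrite -E; auto_derive; [lra|field; lra].
- by rewrite -E'; auto_derive; [lra|field; lra].
- by auto_derive; [|ring].
Qed.

(** Once the symbols and their derivatives are in closed form, each of the 25 components is a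
    rational identity in z and r. *)
Lemma ads5_ricci (L : R) (p : point 5) (b d : 'I_5) :
  0 < L -> 0 < p z_ -> 0 < p r_ ->
  ricci (ads5 L) b d p =
    - 4 * kron b d * (1 + kron b 4 * (p r_ ^ 2 - 1)) / p z_ ^ 2.
Proof.
move=> HL Hz Hr; rewrite /ricci.
transitivity (\sum_(a < 5)
   (kron a 1 * ((kron a d * kron b 1 + kron a b * kron d 1
     - kron a 1 * kron d b * (1 + kron d 4 * (p r_ ^ 2 - 1))) / p z_ ^ 2)
    + kron a 3 * (kron a 1 * kron d b * kron d 4 * (2 * p r_) / p z_
      - kron a 3 * kron d 4 * kron b 4
      - kron a 4 * (kron d 3 * kron b 4 + kron d 4 * kron b 3) / p r_ ^ 2)
   - (kron d 1 * ((kron a a * kron b 1 + kron a b * kron a 1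
     - kron a 1 * kron a b * (1 + kron a 4 * (p r_ ^ 2 - 1))) / p z_ ^ 2)
    + kron d 3 * (kron a 1 * kron a b * kron a 4 * (2 * p r_) / p z_
      - kron a 3 * kron a 4 * kron b 4
      - kron a 4 * (kron a 3 * kron b 4 + kron a 4 * kron b 3) / p r_ ^ 2))
   + \sum_(e < 5) (ads5_christoffel a a e (p z_) (p r_) * ads5_christoffel e d b (p z_) (p r_)
      - ads5_christoffel a d e (p z_) (p r_) * ads5_christoffel e a b (p z_) (p r_)))).
  apply: eq_bigr => a _; rewrite /riemann !partial_ads5_christoffel //.
  by congr (_ + _); apply: eq_bigr => e _; rewrite !ads5_christoffelE.
rewrite !big_ord_recl !big_ord0 /ads5_christoffel /kron.
move: (p z_) (p r_) Hz Hr => z r Hz Hr.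
case: b => -[|[|[|[|[|//]]]]] Hb; case: d => -[|[|[|[|[|//]]]]] Hd;
rewrite /=; field; repeat split; lra.
Qed.

Lemma ads5_scalar_curvature (L : R) (p : point 5) :
  0 < L -> 0 < p z_ -> 0 < p r_ -> scalar_curvature (ads5 L) p = - 20 / L ^ 2.
Proof.
move=> HL Hz Hr; rewrite ads5_diagonal diagonal_metric_scalar_curvature; last first.
  by move=> i; exact: ads5_factor_neq0.
rewrite -ads5_diagonal (eq_bigr (fun _ => - 4 / L ^ 2)) => [|a _].
  by rewrite !big_ord_recl big_ord0; field; lra.
rewrite ads5_ricci // /ads5_factor /kron /vec.
by case: a => -[|[|[|[|[|//]]]]] Ha /=; field; lra.
Qed.

Lemma ads5_einstein (L : R) (p : point 5) (b d : 'I_5) :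
  0 < L -> 0 < p z_ -> 0 < p r_ -> ricci (ads5 L) b d p = - 4 / L ^ 2 * ads5 L p b d.
Proof.
move=> HL Hz Hr; rewrite ads5_ricci // mxE {1}/kron (inj_eq val_inj).
case: eqP => _; last by rewrite Rmult_0_r Rmult_0_l Rdiv_0_l Rmult_0_r.
by rewrite /kron /vec; case: b => -[|[|[|[|[|//]]]]] Hb /=; field; lra.
Qed.

(** * Geometry of the cylinder *)

(** The parameters are ordered z, theta, x3 and the ambient coordinates t, z, x3, r, theta; hence
    [kron i 2] in slot 2 and [kron i 1] in slot 4. *)
Definition cylinder_tangent (d : R) (i : nat) : point 5 :=
  vec 5 [:: 0; kron i 0; kron i 2; kron i 0 * d; kron i 1].

Lemma cylinder_tangentE (t0 : R) (rho : R -> R) (i : 'I_3) (u : point 3) :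
  tangent (cylinder t0 rho) i u =1 cylinder_tangent (Derive rho (u (inord 0))) i.
Proof.
rewrite /tangent /partial => c; rewrite /cylinder /cylinder_tangent /upd /vec /kron.
case: i => -[|[|[|//]]] Hi; case: c => -[|[|[|[|[|//]]]]] Hc;
  rewrite /= -?(inj_eq val_inj) /= ?inordK //= ?Rmult_1_l ?Rmult_0_l;
  try exact: Derive_const; try exact: Derive_id.
by congr (Derive _ (u _)); apply: val_inj; rewrite /= inordK.
Qed.

Definition cylinder_factor (L : R) (rho : R -> R) (i : nat) (z : R) : R :=
  L ^ 2 / z ^ 2 * nth 0 [:: 1 + Derive rho z ^ 2; rho z ^ 2; 1] i.

Lemma cylinder_z (t0 : R) (rho : R -> R) (u : point 3) :
  cylinder t0 rho u z_ = u (inord 0).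
Proof. by rewrite /cylinder /vec /z_ inordK. Qed.

Lemma cylinder_r (t0 : R) (rho : R -> R) (u : point 3) :
  cylinder t0 rho u r_ = rho (u (inord 0)).
Proof. by rewrite /cylinder /vec /r_ inordK. Qed.

Lemma inner_eq n (g : metric n) (p v1 v2 w1 w2 : point n) :
  v1 =1 v2 -> w1 =1 w2 -> inner g p v1 w1 = inner g p v2 w2.
Proof. by move=> Hv Hw; do 2! (apply: eq_bigr => ? _); rewrite Hv Hw. Qed.

Lemma cylinder_induced (L t0 : R) (rho : R -> R) :
  induced (ads5 L) (cylinder t0 rho) =
  diagonal_metric 3 (fun i u => cylinder_factor L rho i (u (inord 0))).
Proof.
apply: metric_ext => u; apply/matrixP => i j; rewrite !mxE -(inj_eq val_inj).
rewrite (inner_eq _ _ _ _ _ _ _ (cylinder_tangentE t0 rho i u) (cylinder_tangentE t0 rho j u)).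
rewrite inner_ads5 !big_ord_recl big_ord0 cylinder_z cylinder_r.
rewrite /cylinder_tangent /cylinder_factor /vec /kron.
by case: i => -[|[|[|//]]] Hi; case: j => -[|[|[|//]]] Hj; rewrite /=; ring.
Qed.

Lemma cylinder_factor_gt0 (L : R) (rho : R -> R) (z : R) (i : 'I_3) :
  0 < L -> 0 < z -> 0 < rho z -> 0 < cylinder_factor L rho i z.
Proof.
move=> HL Hz Hr; apply: Rmult_lt_0_compat.
  by apply: Rdiv_lt_0_compat; apply: pow_lt.
have := pow2_ge_0 (Derive rho z); have := pow_lt _ 2 Hr.
by case: i => -[|[|[|//]]] Hi /=; lra.
Qed.

(** Serves both normals, whose components depend on z alone. Each of the three tangent directions
    contributes [- n1 / z] through the conformal factor, the theta circle adds [n3 / rho], and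
    derivatives of the field enter only along z. *)
Lemma cylinder_extrinsic_trace (L t0 : R) (rho : R -> R) (N : point 3 -> point 5)
    (n0 n1 n3 : R -> R) (u : point 3) :
  let z := u (inord 0) in
  0 < L -> 0 < z -> 0 < rho z ->
  (forall v, N v = vec 5 [:: n0 (v (inord 0)); n1 (v (inord 0)); 0; n3 (v (inord 0)); 0]) ->
  extrinsic_trace (ads5 L) (cylinder t0 rho) N u =
    (Derive n1 z + Derive rho z * Derive n3 z) / (1 + Derive rho z ^ 2)
    - 3 * n1 z / z + n3 z / rho z.
Proof.
move=> z HL Hz Hr HN; rewrite /extrinsic_trace.
transitivity (\sum_(i < 3) (/ cylinder_factor L rho i z *
    extrinsic (ads5 L) (cylinder t0 rho) N i i u)).
  have hN0 (i : 'I_3) : cylinder_factor L rho i (u (inord 0)) <> 0.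
    exact: Rgt_not_eq (cylinder_factor_gt0 _ _ _ _ HL Hz Hr).
  apply: eq_bigr => i _; rewrite (big_Rplus_only1 _ i) cylinder_induced.
    by rewrite diagonal_metric_ginv // eqxx.
  by move=> j Hj; rewrite diagonal_metric_ginv // eq_sym (negbTE Hj) Rmult_0_l.
have Hp : 0 < cylinder t0 rho u z_ /\ 0 < cylinder t0 rho u r_.
  by rewrite cylinder_z cylinder_r.
have HDN (i : 'I_3) (a : 'I_5) : partial i (fun w => N w a) u =
    kron i 0 * vec 5 [:: Derive n0 z; Derive n1 z; 0; Derive n3 z; 0] a.
  rewrite /partial /kron.
  transitivity (Derive (fun x => vec 5 [:: n0 (if nat_of_ord i == 0%nat then x else z);
     n1 (if nat_of_ord i == 0%nat then x else z); 0;
     n3 (if nat_of_ord i == 0%nat then x else z); 0] a) (u i)).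
    apply: Derive_ext => x; rewrite HN /upd -(inj_eq val_inj) /= inordK // eq_sym.
    by case: eqP.
  case: eqP => Hi.
    have -> : u i = z by congr (u _); apply: val_inj; rewrite /= inordK.
    by rewrite Rmult_1_l; case: a => -[|[|[|[|[|//]]]]] Ha;
      rewrite /vec /= ?Derive_const //; apply: Derive_ext.
  by rewrite Rmult_0_l Derive_const.
have HK (i : 'I_3) : extrinsic (ads5 L) (cylinder t0 rho) N i i u =
    inner (ads5 L) (cylinder t0 rho u) (cylinder_tangent (Derive rho z) i)
     (fun a => kron i 0 * vec 5 [:: Derive n0 z; Derive n1 z; 0; Derive n3 z; 0] a
       + \sum_(b < 5) \sum_(c < 5) (ads5_christoffel a b c z (rho z) *
          cylinder_tangent (Derive rho z) i b * vec 5 [:: n0 z; n1 z; 0; n3 z; 0] c)).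
  apply: inner_eq; first exact: cylinder_tangentE.
  move=> a; rewrite /covariant HDN; congr (_ + _).
  apply: eq_bigr => b _; apply: eq_bigr => c _.
  by rewrite ads5_christoffelE ?cylinder_tangentE ?HN ?cylinder_z ?cylinder_r //; case: Hp.
rewrite (eq_bigr _ (fun i _ => f_equal (Rmult _) (HK i))).
rewrite !big_ord_recl !big_ord0 !inner_ads5 cylinder_z cylinder_r -/z.
rewrite !big_ord_recl !big_ord0 /cylinder_factor /cylinder_tangent /ads5_christoffel /vec /kron.
move: (Derive rho z) (rho z) Hr => d r Hr; have Hd := pow2_ge_0 d.
by rewrite /=; field; move: Hd => /= Hd; repeat split; lra.
Qed.

(** Since the coefficients depend on the first coordinate only, all other derivatives vanish. The
    first derivatives [f1] are given on a neighbourhood because the Christoffel symbols are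
    differentiated once more. *)
Lemma diagonal_sheet_scalar_curvature (f f1 : nat -> R -> R) (u : point 3) :
  let x := u (inord 0) in
  locally x (fun y => forall i : 'I_3, f i y <> 0 /\ is_derive (f i) y (f1 i y)) ->
  (forall i : 'I_3, ex_derive (f1 i) x) ->
  let f2 i := Derive (f1 i) x in
  scalar_curvature (diagonal_metric 3 (fun i v => f i (v (inord 0)))) u =
  - / f 0%nat x * (f2 1%nat / f 1%nat x + f2 2%nat / f 2%nat x
    - f1 1%nat x ^ 2 / (2 * f 1%nat x ^ 2) - f1 2%nat x ^ 2 / (2 * f 2%nat x ^ 2)
    + f1 1%nat x * f1 2%nat x / (2 * f 1%nat x * f 2%nat x)
    - f1 0%nat x / (2 * f 0%nat x) * (f1 1%nat x / f 1%nat x + f1 2%nat x / f 2%nat x)).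
Proof.
move=> x Hloc Hex f2.
have Hx := locally_singleton _ _ Hloc.
set g := diagonal_metric _ _.
(* The Christoffel symbols as functions of the first coordinate. *)
pose G (a b c : nat) (y : R) := / (2 * f a y) * (kron a c * kron b 0 * f1 a y
  + kron a b * kron c 0 * f1 a y - kron b c * kron a 0 * f1 b y).
have E0 (i : 'I_3) : (inord 0 == i) = (nat_of_ord i == 0%nat).
  by rewrite -(inj_eq val_inj) /= inordK // eq_sym.
have HG (v : point 3) (a b c : 'I_3) :
    (forall i : 'I_3, f i (v (inord 0)) <> 0 /\
       is_derive (f i) (v (inord 0)) (f1 i (v (inord 0)))) ->
    christoffel g a b c v = G a b c (v (inord 0)).
  move=> Hv; have Hpart (i j : 'I_3) :
      partial j (fun v => f i (v (inord 0))) v = kron j 0 * f1 i (v (inord 0)).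
    rewrite /partial /upd E0 /kron; case: eqP => [Hj|_]; last by rewrite Derive_const Rmult_0_l.
    have -> : v j = v (inord 0) by congr (v _); apply: val_inj; rewrite /= inordK.
    by rewrite Rmult_1_l; apply: is_derive_unique; case: (Hv i).
  rewrite /g diagonal_metric_christoffel => [|i]; last by case: (Hv i).
  rewrite !Hpart /G -!(inj_eq val_inj) /kron /=.
  by case: (nat_of_ord a == c); case: (nat_of_ord a == b); case: (nat_of_ord b == c); ring.
(* Their derivatives at [x]; differentiating the prefactor [/ (2 * f a)] reproduces [G] times
   [- f1 a / f a]. *)
pose dG (a b c : nat) := / (2 * f a x) * (kron a c * kron b 0 * f2 a
    + kron a b * kron c 0 * f2 a - kron b c * kron a 0 * f2 b)
  - f1 a x / f a x * G a b c x.
have HdG (i a b c : 'I_3) : partial i (christoffel g a b c) u = kron i 0 * dG a b c.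
  transitivity (partial i (fun v => G a b c (v (inord 0))) u).
    apply: Derive_ext_loc; rewrite /upd.
    (* Moving along the first coordinate stays in the given neighbourhood only for nearby values;
       moving along another one leaves the first coordinate equal to [x]. *)
    case: (eqVneq (inord 0) i) => [E|NE].
      rewrite -{1}E; apply: filter_imp Hloc => y Hy.
      by rewrite HG ?E eqxx.
    by apply: filter_forall => y; rewrite HG (negbTE NE).
  rewrite /partial /upd E0 /kron; case: eqP => [Hi|_]; last by rewrite Derive_const Rmult_0_l.
  have -> : u i = x by congr (u _); apply: val_inj; rewrite /= inordK.
  apply: is_derive_unique; rewrite /dG /G.
  have [Ha Da] := Hx a; have [Hb Db] := Hx b.
  auto_derive.
    by repeat split; try (exact: Hex); try (by eexists; exact: Da);
      apply: Rmult_integral_contrapositive_currified.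
  have eta_f2 (k : nat) : Derive (fun y => f1 k y) x = f2 k by [].
  by rewrite (is_derive_unique _ _ _ Da) !eta_f2; field.
rewrite /g diagonal_metric_scalar_curvature => [|i]; last by case: (Hx i).
transitivity (\sum_(a < 3) (/ f a x * \sum_(b < 3)
   (kron b 0 * dG b a a - kron a 0 * dG b b a
    + \sum_(e < 3) (G b b e x * G e a a x - G b a e x * G e b a x)))).
  apply: eq_bigr => a _; congr (_ * _); apply: eq_bigr => b _.
  by rewrite /riemann !HdG; congr (_ + _); apply: eq_bigr => e _; rewrite !HG.
have [H0 _] := Hx (Ordinal (isT : 0 < 3)%nat).
have [H1 _] := Hx (Ordinal (isT : 1 < 3)%nat).
have [H2 _] := Hx (Ordinal (isT : 2 < 3)%nat).
move: H0 H1 H2; rewrite !big_ord_recl !big_ord0 /dG /G /kron /=.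
by rewrite -[bump 0 0]/1%nat -[bump 0 1]/2%nat => H0 H1 H2; field.
Qed.

(** The time normal has zero trace, so only the normal in the (z, r)-plane contributes. The slope
    appears as [d / z], the combination with a limit at the boundary. *)
Lemma cylinder_normals_extrinsic_trace_sq (L t0 : R) (rho : R -> R) (u : point 3) :
  let z := u (inord 0) in let d := Derive rho z in
  0 < L -> 0 < z -> 0 < rho z -> ex_derive (Derive rho) z ->
  extrinsic_trace_sq (ads5 L) (cylinder t0 rho) (cylinder_normals L rho) u =
    z ^ 2 / (L ^ 2 * (1 + d ^ 2)) *
    (/ rho z + 3 * (d / z) - Derive (Derive rho) z / (1 + d ^ 2)) ^ 2.
Proof.
move=> z d HL Hz Hr Hd; rewrite /extrinsic_trace_sq !big_ord_recl big_ord0.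
rewrite (cylinder_extrinsic_trace _ _ _ _ (fun y => y / L) (fun=> 0) (fun=> 0)) //.
pose w y := sqrt (1 + Derive rho y ^ 2).
rewrite (cylinder_extrinsic_trace _ _ _ _ (fun=> 0)
  (fun y => - (y / L * Derive rho y / w y)) (fun y => y / L / w y)) //.
rewrite -/z !Derive_const -/d.
have Hw : 0 < 1 + d ^ 2 by have := pow2_ge_0 d; lra.
have Hs : 0 < w z := sqrt_lt_R0 _ Hw.
have Hs2 : w z ^ 2 = 1 + d ^ 2 by apply: pow2_sqrt; exact: Rlt_le.
have Dw : is_derive w z (d * Derive (Derive rho) z / w z).
  rewrite /w; auto_derive; first by split.
  rewrite -[1 + Derive rho z * (Derive rho z * 1)]/(1 + Derive rho z ^ 2) -/(w z) -/d.
  by rewrite -[Derive (fun y => Derive rho y) z]/(Derive (Derive rho) z); field; lra.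
have D3 : Derive (fun y => y / L / w y) z =
    / (L * w z) - z * d * Derive (Derive rho) z / (L * w z ^ 3).
  apply: is_derive_unique; auto_derive; first by split; [eexists; exact: Dw|split => //; lra].
  by rewrite (is_derive_unique _ _ _ Dw); field; lra.
have D1 : Derive (fun y => - (y / L * Derive rho y / w y)) z =
    - (d / (L * w z)) - z * Derive (Derive rho) z / (L * w z)
    + z * d ^ 2 * Derive (Derive rho) z / (L * w z ^ 3).
  apply: is_derive_unique; auto_derive; first by split => //; split; [eexists; exact: Dw|split => //; lra].
  rewrite (is_derive_unique _ _ _ Dw) -/d.
  by rewrite -[Derive (fun y => Derive rho y) z]/(Derive (Derive rho) z); field; lra.
rewrite D1 D3; set s := w z in Hs Hs2 *; set d2 := Derive (Derive rho) z.
(* In the derivative part [n1' + rho' n3'] the terms with [s ^ 3] in the denominator cancel. *)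
rewrite -Hs2; have -> : - (d / (L * s)) - z * d2 / (L * s) + z * d ^ 2 * d2 / (L * s ^ 3) +
    d * (/ (L * s) - z * d * d2 / (L * s ^ 3)) = - z * d2 / (L * s) by field; lra.
by field; lra.
Qed.

(** By the Einstein property each of the two unit normals contributes [- 4 / L ^ 2]. *)
Lemma cylinder_ricci_normal (L t0 : R) (rho : R -> R) (u : point 3) :
  0 < L -> 0 < u (inord 0) -> 0 < rho (u (inord 0)) -> ex_derive rho (u (inord 0)) ->
  ricci_normal (ads5 L) (cylinder t0 rho) (cylinder_normals L rho) u = - 8 / L ^ 2.
Proof.
move=> HL Hz Hr Hd; rewrite /ricci_normal.
have [HN _] := cylinder_unit_normals t0 HL Hz Hd.
rewrite (eq_bigr (fun _ => - 4 / L ^ 2)) => [|m _].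
  by rewrite !big_ord_recl big_ord0; field; lra.
transitivity (- 4 / L ^ 2 * inner (ads5 L) (cylinder t0 rho u) (cylinder_normals L rho m u)
   (cylinder_normals L rho m u)); last by rewrite HN eqxx Rmult_1_r.
set k := - 4 / L ^ 2; rewrite /inner big_distrr; apply: eq_bigr => a _.
rewrite /= big_distrr; apply: eq_bigr => b _ /=.
by rewrite ads5_einstein ?cylinder_z ?cylinder_r // -/k; ring.
Qed.

(** * Intrinsic curvature of the cylinder and its entropy density *)

Definition cylinder_factor_derive (L : R) (rho : R -> R) (i : nat) (z : R) : R :=
  L ^ 2 / z ^ 2 * nth 0 [:: 2 * Derive rho z * Derive (Derive rho) z; 2 * rho z * Derive rho z; 0] i
  - 2 / z * cylinder_factor L rho i z.

Lemma cylinder_factor_is_derive (L : R) (rho : R -> R) (z : R) (i : 'I_3) :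
  z <> 0 -> ex_derive rho z -> ex_derive (Derive rho) z ->
  is_derive (cylinder_factor L rho i) z (cylinder_factor_derive L rho i z).
Proof.
move=> Hz H1 H2; rewrite /cylinder_factor_derive /cylinder_factor.
have Hz2 : z * (z * 1) <> 0 by rewrite Rmult_1_r; apply: Rmult_integral_contrapositive_currified.
by case: i => -[|[|[|//]]] Hi /=; auto_derive; try (by repeat split);
  rewrite -?[Derive (fun y => Derive rho y) z]/(Derive (Derive rho) z)
    -?[Derive (fun y => rho y) z]/(Derive rho z); field.
Qed.

Lemma cylinder_factor_derive_is_derive (L : R) (rho : R -> R) (z : R) (i : 'I_3) :
  z <> 0 -> ex_derive rho z -> ex_derive (Derive rho) z -> ex_derive (Derive (Derive rho)) z ->
  is_derive (cylinder_factor_derive L rho i) z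
    (L ^ 2 / z ^ 2 * nth 0 [:: 2 * (Derive (Derive rho) z ^ 2
         + Derive rho z * Derive (Derive (Derive rho)) z);
       2 * (Derive rho z ^ 2 + rho z * Derive (Derive rho) z); 0] i
     - 4 / z * (L ^ 2 / z ^ 2 * nth 0 [:: 2 * Derive rho z * Derive (Derive rho) z;
         2 * rho z * Derive rho z; 0] i)
     + 6 / z ^ 2 * cylinder_factor L rho i z).
Proof.
move=> Hz H1 H2 H3; rewrite /cylinder_factor_derive /cylinder_factor.
have Hz2 : z * (z * 1) <> 0 by rewrite Rmult_1_r; apply: Rmult_integral_contrapositive_currified.
by case: i => -[|[|[|//]]] Hi /=; auto_derive; try (by repeat split);
  rewrite -?[Derive (fun y => Derive (Derive rho) y) z]/(Derive (Derive (Derive rho)) z)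
    -?[Derive (fun y => Derive rho y) z]/(Derive (Derive rho) z)
    -?[Derive (fun y => rho y) z]/(Derive rho z); field.
Qed.

(** The third derivative of [rho] occurs only in the second derivative of the zz coefficient, which
    the curvature formula for such metrics does not contain; the result is of second order in
    [rho]. *)
Lemma cylinder_scalar_curvature (L t0 zmax : R) (rho : R -> R) (u : point 3) :
  let z := u (inord 0) in let d := Derive rho z in let d2 := Derive (Derive rho) z in
  let W := 1 + d ^ 2 in
  0 < L -> 0 < z < zmax ->
  (forall (k : nat) (y : R), 0 < y < zmax -> ex_derive_n rho k y) ->
  (forall y : R, 0 < y < zmax -> 0 < rho y) ->
  scalar_curvature (induced (ads5 L) (cylinder t0 rho)) u =
    - 2 / (L ^ 2 * W) *
    (3 + z ^ 2 * (d2 / (rho z * W) - 2 * (d / z) / rho z + 2 * (d / z) * d2 / W)).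
Proof.
move=> z d d2 W HL Hz Hs Hr; rewrite cylinder_induced.
rewrite (diagonal_sheet_scalar_curvature _ (cylinder_factor_derive L rho)) -/z; last first.
- move=> i; eexists; apply: cylinder_factor_derive_is_derive;
    [lra|exact: (Hs 1%nat)|exact: (Hs 2%nat)|exact: (Hs 3%nat)].
- apply: filter_imp (filter_and _ _ (open_gt 0 z (proj1 Hz)) (open_lt zmax z (proj2 Hz))).
  move=> y Hy i; split; first exact: Rgt_not_eq (cylinder_factor_gt0 _ _ _ _ HL (proj1 Hy) (Hr y Hy)).
  by apply: cylinder_factor_is_derive; [lra|exact: (Hs 1%nat)|exact: (Hs 2%nat)].
have Hder (i : 'I_3) := is_derive_unique _ _ _ (cylinder_factor_derive_is_derive L rho z i
  (Rgt_not_eq _ _ (proj1 Hz)) (Hs 1%nat z Hz) (Hs 2%nat z Hz) (Hs 3%nat z Hz)).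
have := Hder (Ordinal (isT : 1 < 3)%nat); have := Hder (Ordinal (isT : 2 < 3)%nat) => /= -> ->.
rewrite /cylinder_factor_derive /cylinder_factor /= -/d -/d2 /W.
have Hd := pow2_ge_0 d; move: (rho z) (Hr z Hz) => r H.
by move: Hd => /= Hd; field; repeat split; lra.
Qed.

(** The prefactor is the volume element. The constants are [2 * alpha1] times the ambient scalar
    curvature [- 20 / L ^ 2] and [alpha2] times the normal Ricci term [- 8 / L ^ 2]; the last two
    terms come from the extrinsic trace and the intrinsic curvature. *)
Definition cylinder_density (th : quadratic_gravity) (L : R) (rho : R -> R) (z : R) : R :=
  let d := Derive rho z in let d2 := Derive (Derive rho) z in let W := 1 + d ^ 2 in
  L ^ 3 / z ^ 3 * (rho z * sqrt W) *
  (1 - (40 * alpha1 th + 8 * alpha2 th) / L ^ 2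
   - alpha2 th / (2 * L ^ 2) * (z ^ 2 / W * (/ rho z + 3 * (d / z) - d2 / W) ^ 2)
   - 4 * alpha3 th / L ^ 2 * (/ W *
      (3 + z ^ 2 * (d2 / (rho z * W) - 2 * (d / z) / rho z + 2 * (d / z) * d2 / W)))).

Lemma cylinder_entropy_density (th : quadratic_gravity) (L t0 zmax : R) (rho : R -> R) (u : point 3) :
  let z := u (inord 0) in
  0 < L -> 0 < z < zmax ->
  (forall (k : nat) (y : R), 0 < y < zmax -> ex_derive_n rho k y) ->
  (forall y : R, 0 < y < zmax -> 0 < rho y) ->
  entropy_density th (ads5 L) (cylinder t0 rho) (cylinder_normals L rho) u =
  cylinder_density th L rho z.
Proof.
move=> z HL Hz Hs Hr; have Hrz := Hr z Hz; have Hz0 := proj1 Hz.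
rewrite /entropy_density (cylinder_scalar_curvature _ _ zmax) //.
rewrite cylinder_normals_extrinsic_trace_sq //; last exact: (Hs 2%nat).
rewrite cylinder_ricci_normal //; last exact: (Hs 1%nat).
rewrite ads5_scalar_curvature ?cylinder_z ?cylinder_r //.
rewrite cylinder_induced diagonal_metric_det -/z /cylinder_density.
set d := Derive rho z; set d2 := Derive (Derive rho) z.
have Hd := pow2_ge_0 d.
have -> : \big[Rmult/1]_(i < 3) cylinder_factor L rho i z =
    (L ^ 3 / z ^ 3 * rho z) ^ 2 * (1 + d ^ 2).
  by rewrite !big_ord_recl big_ord0 /cylinder_factor /= -/d; field; lra.
have Hpos : 0 <= L ^ 3 / z ^ 3 * rho z.
  by apply: Rlt_le; apply: Rmult_lt_0_compat => //; apply: Rdiv_lt_0_compat; apply: pow_lt.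
rewrite sqrt_mult; [|exact: pow2_ge_0|lra].
rewrite sqrt_pow2 // -!(Rmult_assoc _ (rho z)).
by congr (_ * _); field; move: Hd => /= Hd; repeat split; lra.
Qed.

(** * Expansions near the boundary *)

Definition bigO (n : nat) (f : R -> R) : Prop :=
  exists M, at_right 0 (fun z => Rabs (f z) <= M * z ^ n).

Lemma at_right_gt0 : at_right 0 (fun z => 0 < z).
Proof. by exists (mkposreal 1 Rlt_0_1). Qed.

Lemma at_right_lt (e : R) : 0 < e -> at_right 0 (fun z => z < e).
Proof.
move=> He; exists (mkposreal e He) => y /=.
by rewrite /ball /= /AbsRing_ball /abs /minus /plus /opp /= => /Rabs_def2 [? ?] _; lra.
Qed.

Lemma bigO_ext (n : nat) (f g : R -> R) :
  at_right 0 (fun z => f z = g z) -> bigO n f -> bigO n g.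
Proof.
by move=> H [M HM]; exists M; apply: filter_imp (filter_and _ _ H HM) => z [->].
Qed.

Lemma bigO_plus (n : nat) (f g : R -> R) :
  bigO n f -> bigO n g -> bigO n (fun z => f z + g z).
Proof.
move=> [M HM] [N HN]; exists (M + N); apply: filter_imp (filter_and _ _ HM HN) => z [Hf Hg].
by have := Rabs_triang (f z) (g z); lra.
Qed.

Lemma bigO_mult (n m : nat) (f g : R -> R) :
  bigO n f -> bigO m g -> bigO (n + m) (fun z => f z * g z).
Proof.
move=> [M HM] [N HN]; exists (M * N); apply: filter_imp (filter_and _ _ HM HN) => z [Hf Hg].
rewrite Rabs_mult -plusE pow_add.
have -> : M * N * (z ^ n * z ^ m) = (M * z ^ n) * (N * z ^ m) by ring.
by apply: Rmult_le_compat => //; exact: Rabs_pos.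
Qed.

Lemma bigO_const (c : R) : bigO 0 (fun=> c).
Proof. by exists (Rabs c); apply: filter_forall => z; rewrite /= Rmult_1_r; exact: Rle_refl. Qed.

Lemma bigO_pow (n : nat) : bigO n (fun z => z ^ n).
Proof.
exists 1; apply: filter_imp at_right_gt0 => z Hz.
by rewrite Rmult_1_l Rabs_pos_eq; [exact: Rle_refl|apply: pow_le; lra].
Qed.

Lemma bigO_leq (n m : nat) (f : R -> R) : (n <= m)%nat -> bigO m f -> bigO n f.
Proof.
move=> Hnm [M HM]; exists (Rabs M).
apply: filter_imp (filter_and _ _ HM (filter_and _ _ at_right_gt0 (at_right_lt 1 Rlt_0_1))).
move=> z [Hf [Hz0 Hz1]].
have Hn : 0 < z ^ n by apply: pow_lt.
have Hm : 0 < z ^ m by apply: pow_lt.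
have Hle : z ^ m <= z ^ n.
  rewrite -(subnK Hnm) -plusE pow_add.
  have : z ^ (m - n) <= 1 by rewrite -(pow1 (m - n)); apply: pow_incr; lra.
  by move=> ?; nra.
have := Rle_abs M; have := Rabs_pos M => ? ?; nra.
Qed.

Lemma bigO_small (f : R -> R) (e : R) : 0 < e -> bigO 1 f -> at_right 0 (fun z => Rabs (f z) < e).
Proof.
move=> He [M HM]; have HM1 : 0 < Rabs M + 1 by have := Rabs_pos M; lra.
apply: filter_imp (filter_and _ _ HM (filter_and _ _ at_right_gt0
  (at_right_lt (e / (Rabs M + 1)) (Rdiv_lt_0_compat _ _ He HM1)))).
move=> z [Hf [Hz0 Hz1]].
have : z * (Rabs M + 1) < e by apply/Rlt_div_r.
by have := Rle_abs M; rewrite pow_1 in Hf; nra.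
Qed.

(* For [n <= 2] the coefficient [b] carries no information. *)
Definition jet (n : nat) (f : R -> R) (a b : R) : Prop :=
  bigO n (fun z => f z - (a + b * z ^ 2)).

Lemma jet_ext (n : nat) (f g : R -> R) (a b a' b' : R) :
  at_right 0 (fun z => f z = g z) -> a = a' -> b = b' -> jet n f a b -> jet n g a' b'.
Proof. by move=> H <- <-; apply: bigO_ext; apply: filter_imp H => z ->. Qed.

Lemma jet_const (n : nat) (c : R) : jet n (fun=> c) c 0.
Proof.
by exists 0; apply: filter_forall => z; rewrite Rmult_0_l Rplus_0_r Rminus_diag Rabs_R0 Rmult_0_l;
  exact: Rle_refl.
Qed.

Lemma jet_plus (n : nat) (f g : R -> R) (a b a' b' : R) :
  jet n f a b -> jet n g a' b' -> jet n (fun z => f z + g z) (a + a') (b + b').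
Proof.
move=> Hf Hg; apply: bigO_ext (bigO_plus _ _ _ Hf Hg).
by apply: filter_forall => z; ring.
Qed.

Lemma jet_bounded (n : nat) (f : R -> R) (a b : R) : jet n f a b -> bigO 0 f.
Proof.
move=> Hf; have Hp := bigO_plus _ _ _ (bigO_const a)
  (bigO_leq 0 _ _ (leq0n _) (bigO_mult _ _ _ _ (bigO_const b) (bigO_pow 2))).
apply: bigO_ext (bigO_plus _ _ _ (bigO_leq 0 _ _ (leq0n _) Hf) Hp).
by apply: filter_forall => z; ring.
Qed.

(** With P and Q the two quadratic polynomials, the error is [(f - P) g + P (g - Q) + b b' z ^ 4];
    the last term is the reason for [n <= 4]. *)
Lemma jet_mult (n : nat) (f g : R -> R) (a b a' b' : R) :
  (n <= 4)%nat -> jet n f a b -> jet n g a' b' ->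
  jet n (fun z => f z * g z) (a * a') (a * b' + b * a').
Proof.
move=> Hn Hf Hg; have Bg := jet_bounded _ _ _ _ Hg.
have BP : bigO 0 (fun z => a + b * z ^ 2).
  by apply: (jet_bounded n _ a b); apply: bigO_ext (jet_const n 0); apply: filter_forall => z; ring.
have H1 := bigO_mult _ _ _ _ Hf Bg; rewrite addn0 in H1.
have H2 := bigO_mult _ _ _ _ BP Hg; rewrite add0n in H2.
have H3 := bigO_leq _ _ _ Hn (bigO_mult _ _ _ _ (bigO_const (b * b')) (bigO_pow 4)).
apply: bigO_ext (bigO_plus _ _ _ (bigO_plus _ _ _ H1 H2) H3).
by apply: filter_forall => z; ring.
Qed.

Lemma jet_leading (n : nat) (f : R -> R) (a b : R) :
  (0 < n)%nat -> jet n f a b -> jet 1 f a 0.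
Proof.
move=> Hn Hf.
have H2 := bigO_leq 1 _ _ (isT : (1 <= 0 + 2)%nat) (bigO_mult _ _ _ _ (bigO_const b) (bigO_pow 2)).
apply: bigO_ext (bigO_plus _ _ _ (bigO_leq _ _ _ Hn Hf) H2).
by apply: filter_forall => z; ring.
Qed.

Lemma jet_near (n : nat) (f : R -> R) (a b e : R) :
  (0 < n)%nat -> 0 < e -> jet n f a b -> at_right 0 (fun z => Rabs (f z - a) < e).
Proof.
move=> Hn He Hf; have := bigO_small _ _ He (jet_leading _ _ _ _ Hn Hf).
by apply: filter_imp => z; rewrite Rmult_0_l Rplus_0_r.
Qed.

Lemma jet_poly (n : nat) (a b : R) : jet n (fun z => a + b * z ^ 2) a b.
Proof. by apply: bigO_ext (jet_const n 0); apply: filter_forall => z; ring. Qed.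

(** Let Q be the proposed expansion of the inverse. The quadratic coefficient of [f Q] vanishes, so
    [f Q - 1] is small, and multiplying by [- / f], bounded because [f] stays away from 0, gives the
    error. *)
Lemma jet_inv (n : nat) (f : R -> R) (a b : R) :
  (0 < n)%nat -> (n <= 4)%nat -> a <> 0 -> jet n f a b ->
  jet n (fun z => / f z) (/ a) (- b / a ^ 2).
Proof.
move=> Hn0 Hn4 Ha Hf; have Ha0 := Rabs_pos_lt a Ha.
have Hbd : at_right 0 (fun z => Rabs a / 2 < Rabs (f z)).
  apply: filter_imp (jet_near _ _ _ _ (Rabs a / 2) Hn0 _ Hf); last by lra.
  move=> z; rewrite Rabs_minus_sym => H.
  by have := Rabs_triang_inv a (f z); lra.
have Binv : bigO 0 (fun z => - / f z).
  exists (2 / Rabs a); apply: filter_imp Hbd => z H; rewrite Rabs_Ropp Rabs_inv /= Rmult_1_r.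
  have -> : 2 / Rabs a = / (Rabs a / 2) by field; lra.
  by apply: Rinv_le_contravar; lra.
have := bigO_mult _ _ _ _ Binv (jet_mult _ _ _ _ _ _ _ Hn4 Hf (jet_poly n (/ a) (- b / a ^ 2))).
rewrite add0n; apply: bigO_ext; apply: filter_imp Hbd => z H.
have Hfz : f z <> 0 by move=> E; rewrite E Rabs_R0 in H; lra.
by field.
Qed.

(** Writes the error as [(f - Q ^ 2) / (sqrt f + Q)] with [Q = 1 + b / 2 * z ^ 2]; the denominator
    is eventually above 1/2. *)
Lemma jet_sqrt (n : nat) (f : R -> R) (b : R) :
  (0 < n)%nat -> (n <= 4)%nat -> jet n f 1 b -> jet n (fun z => sqrt (f z)) 1 (b / 2).
Proof.
move=> Hn0 Hn4 Hf; pose Q z := 1 + b / 2 * z ^ 2; have HQ := jet_poly n 1 (b / 2).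
have H : at_right 0 (fun z => 0 < f z /\ / 2 < Q z).
  have Hh : 0 < / 2 by lra.
  apply: filter_imp (filter_and _ _ (jet_near _ _ _ _ _ Hn0 Hh Hf) (jet_near _ _ _ _ _ Hn0 Hh HQ)).
  by move=> z [/Rabs_def2 [? ?] /Rabs_def2 [? ?]]; rewrite /Q; lra.
have Binv : bigO 0 (fun z => / (sqrt (f z) + Q z)).
  exists 2; apply: filter_imp H => z [H1 H2]; have := sqrt_pos (f z) => H3.
  rewrite Rabs_inv Rabs_pos_eq; last lra.
  by apply: (Rle_trans _ (/ / 2)); [apply: Rinv_le_contravar|]; rewrite /=; lra.
have HQ2 := jet_mult _ _ _ _ _ _ _ Hn4 (jet_const n (-1)) (jet_mult _ _ _ _ _ _ _ Hn4 HQ HQ).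
have := bigO_mult _ _ _ _ Binv (jet_plus _ _ _ _ _ _ _ Hf HQ2).
rewrite add0n; apply: bigO_ext; apply: filter_imp H => z [H1 H2]; have := sqrt_pos (f z) => H3.
have -> : 1 + b / 2 * z ^ 2 = Q z by [].
have Hs : sqrt (f z) * sqrt (f z) = f z by apply: sqrt_sqrt; lra.
rewrite -{2}Hs; field; lra.
Qed.

(** Explains why leading-order knowledge of slope and second derivative suffices: the factor [z ^ 2]
    raises their O(z) error to O(z^3), the precision that survives division by [z ^ 3]. *)
Lemma jet_square_mult (f : R -> R) (a : R) :
  jet 1 f a 0 -> jet 3 (fun z => z ^ 2 * f z) 0 a.
Proof.
move=> Hf; apply: bigO_ext (bigO_mult _ _ _ _ (bigO_pow 2) Hf).
by apply: filter_forall => z; ring.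
Qed.

(** * Uniqueness of the logarithmic term *)

Section RealLimits.
Context {T : Type} (F : (T -> Prop) -> Prop) {FF : Filter F}.

Lemma filterlim_Rplus (f g : T -> R) (a b : R) :
  filterlim f F (locally a) -> filterlim g F (locally b) ->
  filterlim (fun x => f x + g x) F (locally (a + b)).
Proof. by move=> Hf Hg; exact: (filterlim_comp_2 f g _ Hf Hg (filterlim_plus a b)). Qed.

Lemma filterlim_Rmult (f g : T -> R) (a b : R) :
  filterlim f F (locally a) -> filterlim g F (locally b) ->
  filterlim (fun x => f x * g x) F (locally (a * b)).
Proof. by move=> Hf Hg; exact: (filterlim_comp_2 f g _ Hf Hg (filterlim_mult a b)). Qed.

Lemma filterlim_Rminus (f g : T -> R) (a b : R) :
  filterlim f F (locally a) -> filterlim g F (locally b) ->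
  filterlim (fun x => f x - g x) F (locally (a - b)).
Proof.
move=> Hf Hg; apply: filterlim_Rplus Hf _.
exact: (filterlim_comp _ _ _ _ _ _ _ _ Hg (filterlim_opp b)).
Qed.

End RealLimits.

(** Induction on the polynomial: [x] times the value of [p X + c] at [/ x] is [p] at [/ x] plus
    [c x], so [p] at [/ x] also tends to 0. Then [p] is zero and the remaining constant [c] is its
    own limit. *)
Lemma poly_inv_cvg0 (p : {poly R}) :
  filterlim (fun x => p.[/ x]%ring) (at_right 0) (locally 0) -> p = 0%ring.
Proof.
have Hid : filterlim (fun x : R => x) (at_right 0) (locally 0).
  by move=> P HP; apply: filter_le_within.
elim/poly_ind: p => [//|p c IH] Hp.
have Hq : filterlim (fun x => p.[/ x]%ring) (at_right 0) (locally 0).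
  have H : filterlim (fun x => x * (p * 'X + c%:P).[/ x]%ring - c * x) (at_right 0)
      (locally (0 * 0 - c * 0)).
    apply: filterlim_Rminus; first exact: filterlim_Rmult.
    by apply: filterlim_Rmult => //; exact: filterlim_const.
  have E0 : 0 * 0 - c * 0 = 0 by ring.
  rewrite E0 in H; apply: filterlim_ext_loc H; apply: filter_imp at_right_gt0 => x Hx.
  rewrite !hornerE /= -[(_ * / x)%ring]/(p.[/ x]%ring * / x) -[(_ + c)%ring]/(p.[/ x]%ring * / x + c).
  by field; lra.
have p0 := IH Hq; move: Hp; rewrite p0 GRing.mul0r GRing.add0r => Hc.
have -> : c = 0; last by rewrite polyC0.
apply: (filterlim_locally_unique (fun=> c) (F := at_right 0)).
- exact: filterlim_const.
- by apply: filterlim_ext Hc => x; rewrite hornerC.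
Qed.

Lemma has_log_term_unique (S : R -> R) (l B1 B2 : R) :
  0 < l -> has_log_term S l B1 -> has_log_term S l B2 -> B1 = B2.
Proof.
move=> Hl [K1 [a1 [C1 H1]]] [K2 [a2 [C2 H2]]].
pose P K (a : nat -> R) : {poly R} := (\sum_(1 <= k < K.+1) a k *: 'X^k)%ring.
have HP K a x : \sum_(1 <= k < K.+1) (a k / x ^ k) = (P K a).[/ x]%ring.
  by rewrite /P horner_sum; apply: eq_bigr => k _; rewrite !hornerE /Rdiv -pow_inv RpowE.
pose p := (P K2 a2 - P K1 a1)%ring.
have HD : filterlim (fun x => p.[/ x]%ring + (B2 - B1) * ln (l / x)) (at_right 0)
    (locally (C1 - C2)).
  refine (filterlim_ext _ _ _ (filterlim_Rminus _ _ _ _ _ H1 H2)) => x; rewrite /p hornerD hornerN !HP.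
  move: (_.[_])%ring (_.[_])%ring => u v.
  by rewrite -[(u - v)%ring]/(u - v); ring.
clearbody p.
have Hhalf : filterlim (fun x => x / 2) (at_right 0) (at_right 0).
  move=> Q [e He]; exists e => y Hy Hy0; apply: He; last by lra.
  move: Hy; rewrite /ball /= /AbsRing_ball /abs /minus /plus /opp /=.
  by move=> /Rabs_def2 [? ?]; apply: Rabs_def1; lra.
(* At [/ x] this is the function of [HD] at [x / 2] minus its value at [x]; halving the argument
   raises the logarithm by [ln 2]. *)
pose q := (p \Po (2 *: 'X) - p + ((B2 - B1) * ln 2)%:P)%ring.
have Hq : filterlim (fun x => q.[/ x]%ring) (at_right 0) (locally 0).
  rewrite -[X in locally X](Rminus_diag (C1 - C2)).
  refine (filterlim_ext_loc _ _ _ (filterlim_Rminus _ _ _ _ _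
    (filterlim_comp _ _ _ _ _ _ _ _ Hhalf HD) HD)); apply: filter_imp at_right_gt0 => x Hx.
  rewrite /q !hornerE horner_comp !hornerE.
  have -> : / (x / 2) = (2 * / x)%ring by rewrite -[(2 * / x)%ring]/(2 * / x); field; lra.
  have -> : l / (x / 2) = 2 * (l / x) by field; lra.
  rewrite ln_mult; [|lra|by apply: Rdiv_lt_0_compat].
  move: (p.[2 * / x])%ring (p.[/ x])%ring => u v.
  by rewrite -[(u - v + _)%ring]/(u - v + (B2 - B1) * ln 2); ring.
(* At 0 the two copies of [p] cancel, which leaves [(B2 - B1) * ln 2]. *)
have := congr1 (fun r : {poly R} => r.[0]%ring) (poly_inv_cvg0 _ Hq).
rewrite /q !hornerE horner_comp !hornerE => H.
have Hln : (B2 - B1) * ln 2 = 0 by rewrite GRing.subrr GRing.add0r in H.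
case: (Rmult_integral _ _ Hln) => [|E]; first by lra.
by have := ln_lt_2; lra.
Qed.

(** * The logarithmic term of the entropy *)

(** The singular part [P] has the primitive [K]. The remainder [E] is bounded near 0, so its
    integral from [delta] is Cauchy as [delta] tends to 0 and only adds to the constant. *)
Lemma RInt_log_expansion (F : R -> R) (A B l z0 : R) :
  0 < l -> 0 < z0 -> (forall z, 0 < z <= z0 -> continuous F z) ->
  bigO 0 (fun z => F z - (A / z ^ 3 + B / z)) ->
  exists C, filterlim (fun delta => RInt F delta z0 - A / (2 * delta ^ 2) - B * ln (l / delta))
    (at_right 0) (locally C).
Proof.
move=> Hl Hz0 HF [M [e He]].
pose P z := A / z ^ 3 + B / z; pose E z := F z - P z; pose K z := - A / (2 * z ^ 2) + B * ln z.
have HPc z : 0 < z -> continuous P z.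
  move=> Hz; apply: ex_derive_continuous; rewrite /P; auto_derive.
  by repeat split; try lra; apply: Rgt_not_eq; do! apply: Rmult_lt_0_compat => //; lra.
have HEc z : 0 < z <= z0 -> continuous E z.
  by move=> Hz; apply: (continuous_minus F P); [exact: HF|apply: HPc; lra].
have exI (f : R -> R) a b : (forall z, 0 < z <= z0 -> continuous f z) ->
    0 < a -> a <= b -> b <= z0 -> ex_RInt f a b.
  move=> Hf Ha Hab Hb; apply: ex_RInt_continuous => z.
  by rewrite Rmin_left // Rmax_right // => ?; apply: Hf; lra.
have HPI d : 0 < d <= z0 -> is_RInt P d z0 (K z0 - K d).
  move=> Hd; apply: (is_RInt_derive K P) => z; rewrite Rmin_left ?Rmax_right; try lra;
    move=> Hz; last by apply: HPc; lra.
  rewrite /K /P; auto_derive; last by field; lra.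
  by repeat split; try lra; apply: Rgt_not_eq; do! apply: Rmult_lt_0_compat => //; lra.
(* The two integrals differ by the integral of [E] over [[d1, d2]], where [M] bounds it. *)
have HM d1 d2 : 0 < d1 -> d1 <= d2 -> d2 <= z0 -> d2 < e ->
    Rabs (RInt E d1 z0 - RInt E d2 z0) <= (d2 - d1) * Rabs M.
  move=> H1 H12 H2 H2e.
  rewrite -(RInt_Chasles E d1 d2 z0); [|exact: exI|apply: exI => //; lra].
  rewrite /plus /= (_ : forall x y, x + y - y = x) => [|x y]; last by ring.
  apply: abs_RInt_le_const => // [|t Ht]; first exact: exI.
  apply: Rle_trans (Rle_abs M); rewrite -[M]Rmult_1_r; apply: He; last by lra.
  rewrite /ball /= /AbsRing_ball /abs /minus /plus /opp /=.
  by apply: Rabs_def1; lra.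
have [C HC] : exists C, filterlim (fun d => RInt E d z0) (at_right 0) (locally C).
  apply/(filterlim_locally_cauchy (U := R_CompleteSpace)) => eps.
  have HM0 : 0 < Rabs M + 1 by have := Rabs_pos M; lra.
  exists (fun d => 0 < d /\ (d < z0 /\ (d < e /\ d < eps / (Rabs M + 1)))); split.
    apply: filter_and at_right_gt0 _; apply: filter_and (at_right_lt _ Hz0) _.
    apply: filter_and (at_right_lt _ (cond_pos e)) _; apply: at_right_lt.
    by apply: Rdiv_lt_0_compat => //; exact: cond_pos.
  move=> d1 d2 [H1 [H1z [H1e H1M]]] [H2 [H2z [H2e H2M]]].
  have small d : d < eps / (Rabs M + 1) -> d * (Rabs M + 1) < eps by move=> ?; apply/Rlt_div_r.
  have {}H1M := small _ H1M; have {}H2M := small _ H2M.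
  rewrite /ball /= /AbsRing_ball /abs /minus /plus /opp /=.
  have := Rabs_pos M => ?.
  case: (Rle_lt_dec d1 d2) => H12.
    rewrite Rabs_minus_sym; apply: Rle_lt_trans (HM d1 d2 _ _ _ _) _; try lra; nra.
  by apply: Rle_lt_trans (HM d2 d1 _ _ _ _) _; try lra; nra.
(* The lower endpoint gives [- K d = A / (2 d ^ 2) - B ln d]; subtracting [B ln (l / d)] removes its
   logarithm and leaves [- B ln l]. *)
exists (C + (K z0 - B * ln l)).
refine (filterlim_ext_loc _ _ _ (filterlim_Rplus _ _ _ _ _ HC (filterlim_const (K z0 - B * ln l)))).
apply: filter_imp (filter_and _ _ at_right_gt0 (at_right_lt _ Hz0)) => d [Hd Hdz].
have HdI : 0 < d <= z0 by lra.
have -> : RInt F d z0 = RInt E d z0 + (K z0 - K d).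
  rewrite -(is_RInt_unique _ _ _ _ (HPI d HdI)).
  rewrite -[_ + _](RInt_plus E P); first by apply: RInt_ext => z _; rewrite /E /plus /=; ring.
    by apply: exI => //; lra.
  by eexists; exact: HPI.
rewrite /K ln_div //; field; lra.
Qed.

(** * Power bounds from the prescribed boundary expansion *)

Lemma Rmult_ln_le1 (z : R) : 0 < z < 1 -> z * (1 + Rabs (ln z)) <= 1.
Proof.
move=> [Hz0 Hz1]; have Hln : ln z < 0 by rewrite -ln_1; apply: ln_increasing.
(* The inequality [1 + x <= exp x] at [x = - ln z] reads [1 - ln z <= / z]. *)
rewrite Rabs_left //; have := exp_ineq1_le (- ln z).
rewrite exp_Ropp exp_ln // => H; apply: (Rle_trans _ (z * / z)).
  by apply: Rmult_le_compat_l; lra.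
by right; field; lra.
Qed.

(** One power of z is spent on absorbing [1 + Rabs (ln z)], which lowers the order from [4 - k] to
    [3 - k]. *)
Lemma near_boundary_bigO (l : R) (rho : R -> R) (k : nat) :
  near_boundary_expansion l rho -> (k <= 2)%nat ->
  bigO (3 - k) (Derive_n (fun y => rho y - l * (1 - y ^ 2 / (4 * l ^ 2))) k).
Proof.
move=> [C [eps [Heps HC]]] Hk; exists (Rabs C).
apply: filter_imp (filter_and _ _ at_right_gt0
  (filter_and _ _ (at_right_lt _ Heps) (at_right_lt _ Rlt_0_1))) => z [Hz0 [Hze Hz1]].
apply: Rle_trans (HC k z Hk (conj Hz0 Hze)) _.
rewrite subSn ?(leq_trans Hk) //=.
have Hp : 0 < z ^ (3 - k) by apply: pow_lt.
have := Rmult_ln_le1 z (conj Hz0 Hz1) => H.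
have Ha : 0 <= z * (1 + Rabs (ln z)).
  by apply: Rmult_le_pos; have := Rabs_pos (ln z); lra.
have -> : C * (z * z ^ (3 - k)) * (1 + Rabs (ln z)) =
  C * ((z * (1 + Rabs (ln z))) * z ^ (3 - k)) by ring.
apply: Rle_trans (Rmult_le_compat_r _ _ _ _ (Rle_abs C)) _; first by apply: Rmult_le_pos; lra.
by apply: Rmult_le_compat_l; [exact: Rabs_pos|nra].
Qed.

Lemma jet1_plus (f g : R -> R) (a b : R) :
  jet 1 f a 0 -> jet 1 g b 0 -> jet 1 (fun z => f z + g z) (a + b) 0.
Proof. by move=> Hf Hg; have := jet_plus _ _ _ _ _ _ _ Hf Hg; rewrite Rplus_0_r. Qed.

Lemma jet1_mult (f g : R -> R) (a b : R) :
  jet 1 f a 0 -> jet 1 g b 0 -> jet 1 (fun z => f z * g z) (a * b) 0.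
Proof.
move=> Hf Hg; have := jet_mult _ _ _ _ _ _ _ (isT : (1 <= 4)%nat) Hf Hg.
by rewrite Rmult_0_r Rmult_0_l Rplus_0_r.
Qed.

Lemma jet1_inv (f : R -> R) (a : R) :
  a <> 0 -> jet 1 f a 0 -> jet 1 (fun z => / f z) (/ a) 0.
Proof.
move=> Ha Hf; have := jet_inv _ _ _ _ (isT : (0 < 1)%nat) (isT : (1 <= 4)%nat) Ha Hf.
by rewrite Ropp_0 Rdiv_0_l.
Qed.

(** * Expansion of the profile and of the entropy density *)

Section CylinderJets.
Variables (l zmax : R) (rho : R -> R).
Hypotheses (Hl : 0 < l) (Hzmax : 0 < zmax) (Hexp : near_boundary_expansion l rho).
Hypothesis Hsmooth : forall (k : nat) (z : R), 0 < z < zmax -> ex_derive_n rho k z.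

Lemma at_right_domain : at_right 0 (fun z => 0 < z < zmax).
Proof. by apply: filter_and at_right_gt0 (at_right_lt _ Hzmax). Qed.

Lemma Derive_near_boundary_error (z : R) : 0 < z < zmax ->
  Derive_n (fun y => rho y - l * (1 - y ^ 2 / (4 * l ^ 2))) 1 z = Derive rho z + z / (2 * l).
Proof.
move=> Hz; change (Derive (fun y => rho y - l * (1 - y ^ 2 / (4 * l ^ 2))) z = Derive rho z + z / (2 * l)).
apply: is_derive_unique; have H1 : ex_derive rho z := Hsmooth 1 z Hz.
by auto_derive => //; rewrite -[Derive (fun y => rho y) z]/(Derive rho z); field; lra.
Qed.

Lemma rho_jet : jet 3 rho l (- / (4 * l)).
Proof.
apply: bigO_ext (near_boundary_bigO _ _ 0 Hexp isT).
by apply: filter_imp at_right_domain => z Hz /=; field; lra.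
Qed.

(** The error of the first derivative is O(z^2), so O(z) is left after division by z. *)
Lemma rho_derive_jet : jet 1 (fun z => Derive rho z / z) (- / (2 * l)) 0.
Proof.
have [M HM] := near_boundary_bigO _ _ 1 Hexp isT; exists M.
apply: filter_imp (filter_and _ _ at_right_domain HM) => z [Hz].
rewrite Derive_near_boundary_error //= !Rmult_1_r => H.
have -> : Derive rho z / z - (- / (2 * l) + 0 * (z * z)) = (Derive rho z + z / (2 * l)) / z.
  by field; lra.
rewrite Rabs_div; last lra.
rewrite (Rabs_pos_eq z); last lra.
by apply/Rle_div_l; lra.
Qed.

Lemma rho_derive2_jet : jet 1 (Derive (Derive rho)) (- / (2 * l)) 0.
Proof.
apply: bigO_ext (near_boundary_bigO _ _ 2 Hexp isT).
apply: filter_imp at_right_domain => z Hz.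
have -> : Derive_n (fun y => rho y - l * (1 - y ^ 2 / (4 * l ^ 2))) 2 z =
    Derive (fun y => Derive rho y + y / (2 * l)) z.
  apply: Derive_ext_loc.
  apply: filter_imp (filter_and _ _ (open_gt 0 z (proj1 Hz)) (open_lt zmax z (proj2 Hz))).
  by move=> y Hy; exact: Derive_near_boundary_error.
have H2 : ex_derive (Derive rho) z := Hsmooth 2 z Hz.
have -> : Derive (fun y => Derive rho y + y / (2 * l)) z = Derive (Derive rho) z + / (2 * l).
  apply: is_derive_unique; auto_derive => //.
  by rewrite -[Derive (fun y => Derive rho y) z]/(Derive (Derive rho) z); field; lra.
by field; lra.
Qed.

Let W z := 1 + Derive rho z ^ 2.

(** Here [W = 1 + z ^ 2 q ^ 2], where [q = rho' / z] tends to [- / (2 l)]. *)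
Lemma slope_jet : jet 3 W 1 (/ (4 * l ^ 2)).
Proof.
have H := jet_square_mult _ _ (jet1_mult _ _ _ _ rho_derive_jet rho_derive_jet).
apply: jet_ext (jet_plus _ _ _ _ _ _ _ (jet_const 3 1) H); [|lra|by field; lra].
by apply: filter_imp at_right_domain => z Hz; rewrite /W; field; lra.
Qed.

Lemma cylinder_density_bigO (th : quadratic_gravity) (L : R) : 0 < L ->
  (forall z, 0 < z < zmax -> 0 < rho z) ->
  let b := - a4_tilde th L / (8 * l) in
  exists a, bigO 0 (fun z => cylinder_density th L rho z - (L ^ 3 * a / z ^ 3 + L ^ 3 * b / z)).
Proof.
move=> HL Hpos b; have l0 : l <> 0 by lra.
have jW := slope_jet; have jr := rho_jet.
have jiW := jet_inv _ _ _ _ (isT : (0 < 3)%nat) isT R1_neq_R0 jW.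
have jsW := jet_sqrt _ _ _ (isT : (0 < 3)%nat) isT jW.
have jiW1 : jet 1 (fun z => / W z) 1 0 by rewrite -Rinv_1; exact: jet_leading jiW.
have jir1 := jet1_inv _ _ l0 (jet_leading 3 _ _ _ isT jr).
have jq := rho_derive_jet; have js := rho_derive2_jet.
have jsW1 := jet1_mult _ _ _ _ js jiW1.
have jk := jet_plus _ _ _ _ _ _ _ (jet_plus _ _ _ _ _ _ _ jir1
  (jet1_mult _ _ _ _ (jet_const 1 3) jq)) (jet1_mult _ _ _ _ (jet_const 1 (-1)) jsW1).
(* The limits of the three terms are [1 / l], [- 3 / (2 l)] and [1 / (2 l)], with sum 0. *)
have {}jk : jet 1 (fun z => / rho z + 3 * (Derive rho z / z) + -1 * (Derive (Derive rho) z * / W z)) 0 0.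
  by apply: jet_ext jk; [exact: filter_forall|field|ring].
have jK := jet_square_mult _ _ (jet1_mult _ _ _ _ jiW1 (jet1_mult _ _ _ _ jk jk)).
(* The three summands tend to [- 1 / (2 l ^ 2)], [1 / l ^ 2] and [1 / (2 l ^ 2)], so the intrinsic
   bracket is [3 + z ^ 2 / l ^ 2 + O(z^3)]. *)
have jT1 := jet1_mult _ _ _ _ jsW1 jir1.
have jT2 := jet1_mult _ _ _ _ (jet_const 1 (-2)) (jet1_mult _ _ _ _ jq jir1).
have jT3 := jet1_mult _ _ _ _ (jet_const 1 2) (jet1_mult _ _ _ _ jq jsW1).
have jT := jet_square_mult _ _ (jet1_plus _ _ _ _ (jet1_plus _ _ _ _ jT1 jT2) jT3).
have jR := jet_mult 3 _ _ _ _ _ _ isT jiW (jet_plus _ _ _ _ _ _ _ (jet_const 3 3) jT).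
have jB := jet_plus _ _ _ _ _ _ _ (jet_plus _ _ _ _ _ _ _
  (jet_const 3 (1 - (40 * alpha1 th + 8 * alpha2 th) / L ^ 2))
  (jet_mult 3 _ _ _ _ _ _ isT (jet_const 3 (- (alpha2 th / (2 * L ^ 2)))) jK))
  (jet_mult 3 _ _ _ _ _ _ isT (jet_const 3 (- (4 * alpha3 th / L ^ 2))) jR).
have := jet_mult 3 _ _ _ _ _ _ isT (jet_mult 3 _ _ _ _ _ _ isT jr jsW) jB.
set num := (X in jet 3 X _ _); set a := (X in jet 3 _ X _); set b' := (X in jet 3 _ _ X).
(* The volume factor is [l - z ^ 2 / (8 l)] and the intrinsic bracket over [W] is
   [3 + z ^ 2 / (4 l ^ 2)], up to O(z^3). Relative to [- 1 / (8 l)] the latter contributes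
   [- 12 + 8 = - 4] times [alpha3 / L ^ 2], as in [a4_tilde]. *)
have -> : b' = b by rewrite /b' /b /a4_tilde; field; lra.
move=> [M HM]; exists a; exists (L ^ 3 * M).
apply: filter_imp (filter_and _ _ at_right_domain HM) => z [Hz].
have Hz3 : 0 < z ^ 3 by apply: pow_lt; lra.
have HL3 : 0 < L ^ 3 by apply: pow_lt.
have HW : 0 < W z by rewrite /W; have := pow2_ge_0 (Derive rho z); lra.
have -> : cylinder_density th L rho z = L ^ 3 / z ^ 3 * num z.
  rewrite /cylinder_density -/(W z) /num; have := Hpos z Hz => Hr.
  by rewrite !Rmult_assoc; do 3! congr (_ * _); field; lra.
have -> : L ^ 3 / z ^ 3 * num z - (L ^ 3 * a / z ^ 3 + L ^ 3 * b / z) =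
    L ^ 3 / z ^ 3 * (num z - (a + b * z ^ 2)) by field; lra.
move=> H; rewrite Rabs_mult Rabs_pos_eq; last by apply: Rlt_le; exact: Rdiv_lt_0_compat.
have -> : L ^ 3 * M * z ^ 0 = L ^ 3 / z ^ 3 * (M * z ^ 3) by rewrite /=; field; lra.
by apply: Rmult_le_compat_l => //; apply: Rlt_le; exact: Rdiv_lt_0_compat.
Qed.

(** Continuity is read off from differentiability; as the density contains the second derivative of
    [rho], this calls on the third. *)
Lemma cylinder_density_continuous (th : quadratic_gravity) (L z : R) : 0 < L ->
  0 < z < zmax -> 0 < rho z -> continuous (cylinder_density th L rho) z.
Proof.
move=> HL Hz Hr; apply: ex_derive_continuous; rewrite /cylinder_density.
have H1 : ex_derive rho z := Hsmooth 1 z Hz.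
have H2 : ex_derive (Derive rho) z := Hsmooth 2 z Hz.
have H3 : ex_derive (Derive (Derive rho)) z := Hsmooth 3 z Hz.
have HW : 0 < 1 + Derive rho z * (Derive rho z * 1).
  by have := pow2_ge_0 (Derive rho z); rewrite /=; lra.
have Hz3 : 0 < z * (z * (z * 1)) by have := pow_lt z 3 (proj1 Hz).
auto_derive; repeat split => //; try lra.
by apply: Rgt_not_eq; apply: Rmult_lt_0_compat; lra.
Qed.

End CylinderJets.

(** The density is constant in theta and x3, whose integrals give [2 * PI * H]. *)
Lemma cylinder_entropy_RInt (th : quadratic_gravity) (L H t0 zmax za zb : R) (rho : R -> R) :
  0 < L -> 0 < za -> za <= zb -> zb < zmax ->
  (forall (k : nat) (z : R), 0 < z < zmax -> ex_derive_n rho k z) ->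
  (forall z : R, 0 < z < zmax -> 0 < rho z) ->
  cylinder_entropy th L H t0 rho za zb =
  PI * H / (2 * newton th) * RInt (cylinder_density th L rho) za zb.
Proof.
move=> HL Ha Hab Hb Hs Hr; rewrite /cylinder_entropy.
have -> : PI * H / (2 * newton th) = / (4 * newton th) * (2 * PI * H).
  (* The reciprocal is abstracted so that [field] raises no condition on [newton th]. *)
  by rewrite /Rdiv !Rinv_mult; move: (/ newton th) => G; field.
rewrite Rmult_assoc; congr (_ * _).
transitivity (RInt (fun z => scal (2 * PI * H) (cylinder_density th L rho z)) za zb); last first.
  apply: RInt_scal; apply: ex_RInt_continuous => z; rewrite Rmin_left // Rmax_right // => Hz.
  by apply: (cylinder_density_continuous zmax) => //; [lra|apply: Hr; lra].
apply: RInt_ext => z; rewrite Rmin_left // Rmax_right // => Hz.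
transitivity (RInt (fun=> RInt (fun=> cylinder_density th L rho z) 0 H) 0 (2 * PI)).
  apply: RInt_ext => theta _; apply: RInt_ext => x3 _.
  have E : vec 3 [:: z; theta; x3] (inord 0) = z by rewrite /vec inordK.
  by rewrite (cylinder_entropy_density _ _ _ zmax) ?E //; lra.
by rewrite !RInt_const /scal /= /mult /=; ring.
Qed.

Theorem mainTheorem20
  (th : quadratic_gravity) (L l H t0 zmax z0 : R) (rho : R -> R)
  (HG : 0 < newton th) (HL : 0 < L) (Hl : 0 < l) (HH : 0 < H)
  (Hvac : is_vacuum th poincare_domain (ads5 L))
  (Hz0 : 0 < z0) (Hzmax : z0 < zmax)
  (Hsmooth : forall (k : nat) (z : R), 0 < z < zmax -> ex_derive_n rho k z)
  (Hpos : forall z : R, 0 < z < zmax -> 0 < rho z)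
  (Hexp : near_boundary_expansion l rho)
  (Hext : is_extremal th L H t0 zmax rho) :
  let S := fun delta : R => cylinder_entropy th L H t0 rho delta z0 in
  has_log_term S l
    (- a4_tilde th L * (PI * H * L ^ 3 / (16 * l * newton th)))
  /\ (forall c : R,
        has_log_term S l (cft_cylinder_coefficient c l H) ->
        c = a4_tilde th L * (PI * L ^ 3 / (8 * newton th))).
Proof.
move=> S.
have Hzmax0 : 0 < zmax by lra.
have Hlog : has_log_term S l (- a4_tilde th L * (PI * H * L ^ 3 / (16 * l * newton th))).
  have [a Ha] := cylinder_density_bigO _ _ _ Hl Hzmax0 Hexp Hsmooth th _ HL Hpos.
  set b := - a4_tilde th L / (8 * l) in Ha.
  have Hc z : 0 < z <= z0 -> continuous (cylinder_density th L rho) z.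
    by move=> Hz; apply: (cylinder_density_continuous zmax) => //; [lra|apply: Hpos; lra].
  have [C HC] := RInt_log_expansion _ _ _ _ _ Hl Hz0 Hc Ha.
  set k := PI * H / (2 * newton th).
  (* The only power divergence is [1 / delta ^ 2], from integrating [L ^ 3 * a / z ^ 3]. *)
  exists 2%nat, (fun i => if i == 2%nat then k * (L ^ 3 * a / 2) else 0), (k * C).
  refine (filterlim_ext_loc _ _ _ (filterlim_Rmult _ _ _ _ _ (filterlim_const k) HC)).
  apply: filter_imp (filter_and _ _ at_right_gt0 (at_right_lt _ Hz0)) => d [Hd Hdz].
  rewrite /S (cylinder_entropy_RInt _ _ _ _ zmax) //; last by lra.
  rewrite big_ltn // big_ltn // big_geq //= -/k.
  have -> : - a4_tilde th L * (PI * H * L ^ 3 / (16 * l * newton th)) = k * (L ^ 3 * b).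
    by rewrite /k /b; field; lra.
  by field; lra.
split=> // c Hc; have := has_log_term_unique _ _ _ _ Hl Hlog Hc.
rewrite /cft_cylinder_coefficient => Heq.
(* Solves the equality of the two logarithmic coefficients for [c]. *)
have -> : c = - (2 * l / H) * - (c * H / (2 * l)) by field; lra.
by rewrite -Heq; field; lra.
Qed.
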